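(* Let $f:\mathbb{R}\to\mathbb{R}$ be a $C^1$ function and $\kappa$ a nonzero constant. Suppose that $u$ is a $C^3$ solution of $$\begin{cases}\mathrm{div}\left(\dfrac{\nabla u}{\sqrt{1+|\nabla u|^2}}\right)+f(u)=0 & \text{in }\mathbb{R}^n_+,\\ u>0 & \text{in }\mathbb{R}^n_+,\\ u=0 & \text{on }\partial\mathbb{R}^n_+,\\ \partial_\nu u=\kappa & \text{on }\partial\mathbb{R}^n_+,\end{cases}$$ with $u\le C$ and $|\nabla u|\le C$ for some constant $C$. If there exists a nonpositive primitive $F$ of $f$ (that is, $F'=f$ and $F\le0$) such that $$F(0)\ge(1+\kappa^2)^{-\frac12}-1,$$ then the solution $u$ is parallel.
   Context: $n\ge2$, $\mathbb{R}^n_+=\{x\in\mathbb{R}^n:x_n>0\}$, and $\nu$ is the exterior unit normal on the boundary. The solution $u$ is of class $C^3$ in the interior and of class $C^1$ up to the boundary. A solution $u$ on a half-space $\{x\in\mathbb{R}^n: a\cdot(x-x_0)>0\}$ (with $x_0,a\in\mathbb{R}^n$) is called parallel if there is a function $g:[0,+\infty)\to\mathbb{R}$ with $u(x)=g(a\cdot(x-x_0))$ there. *)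

(* Defs.v *)
From HB Require Import structures.
From mathcomp Require Import all_boot all_order all_algebra.
From mathcomp Require Import all_classical all_reals all_analysis.

Set Implicit Arguments.
Unset Strict Implicit.
Unset Printing Implicit Defensive.

Import Order.TTheory GRing.Theory Num.Theory.
Import numFieldNormedType.Exports.

Local Open Scope classical_set_scope.
Local Open Scope ring_scope.

Section EuclideanSpace.
Context {R : realType} {n : nat}.
Implicit Types x y : 'rV[R]_n.

Definition dot x y : R := \sum_(i < n) x 0 i * y 0 i.

(* The library norm `|x| on 'rV[R]_n is the sup norm; it induces the same
   topology, but the gradient has to be measured in the Euclidean norm. *)
Definition enorm x : R := Num.sqrt (dot x x).

Definition basis_vec (i : 'I_n) : 'rV[R]_n := delta_mx 0 i.

Definition partial (i : 'I_n) (u : 'rV[R]_n -> R) : 'rV[R]_n -> R :=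
  fun x => 'D_(basis_vec i) u x.

Definition grad (u : 'rV[R]_n -> R) : 'rV[R]_n -> 'rV[R]_n :=
  fun x => \row_(i < n) partial i u x.

Definition divergence (V : 'rV[R]_n -> 'rV[R]_n) : 'rV[R]_n -> R :=
  fun x => \sum_(i < n) partial i (fun y => V y 0 i) x.

Definition mean_curvature_op (u : 'rV[R]_n -> R) : 'rV[R]_n -> R :=
  divergence (fun y => (Num.sqrt (1 + enorm (grad u y) ^+ 2))^-1 *: grad u y).

(* Intended for open A: all partial derivatives of order at most k exist and
   are continuous on A. *)
Fixpoint Ck (k : nat) (A : set 'rV[R]_n) (u : 'rV[R]_n -> R) : Prop :=
  (forall x, A x -> {for x, continuous u}) /\
  match k with
  | 0 => True
  | k'.+1 => forall i : 'I_n,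
      (forall x, A x -> derivable u x (basis_vec i)) /\ Ck k' A (partial i u)
  end.

(* Here u and its first partial derivatives on the open set A extend
   continuously to the closure, with u itself as the extension of u. *)
Definition C1_up_to_boundary (A : set 'rV[R]_n) (u : 'rV[R]_n -> R) : Prop :=
  [/\ Ck 1 A u, {within closure A, continuous u} &
      forall i : 'I_n, exists g : 'rV[R]_n -> R,
        {within closure A, continuous g} /\
        (forall x, A x -> g x = partial i u x)].

(* Derivative at a boundary point x in the exterior direction nu. Only steps
   h < 0 keep x + h *: nu inside the domain, hence the one-sided limit. *)
Definition has_normal_derivative (u : 'rV[R]_n -> R) (x nu : 'rV[R]_n)
    (l : R) : Prop :=
  h^-1 * (u (x + h *: nu) - u x) @[h --> 0^'-] --> l.

Definition half_space (a x0 : 'rV[R]_n) : set 'rV[R]_n :=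
  [set x | 0 < dot a (x - x0)].

(* Only the values of g on ]0, +oo[ matter. *)
Definition parallel (a x0 : 'rV[R]_n) (u : 'rV[R]_n -> R) : Prop :=
  exists g : R -> R,
    forall x, half_space a x0 x -> u x = g (dot a (x - x0)).

End EuclideanSpace.

Section UpperHalfSpace.
Context {R : realType} {n : nat}.

Definition e_last : 'rV[R]_n.+1 := basis_vec ord_max.

Definition upper_half_space : set 'rV[R]_n.+1 := [set x | 0 < x 0 ord_max].

Definition upper_boundary : set 'rV[R]_n.+1 := [set x | x 0 ord_max = 0].

Definition exterior_normal : 'rV[R]_n.+1 := - e_last.

End UpperHalfSpace.

Arguments e_last : clear implicits.
Arguments upper_half_space : clear implicits.
Arguments upper_boundary : clear implicits.
Arguments exterior_normal : clear implicits.

Section RealFunctions.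
Context {R : realType}.
Implicit Types f F : R -> R.

Definition C1_real f : Prop :=
  (forall t, derivable f t 1) /\ continuous (derive1 f).

Definition primitive F f : Prop := forall t : R, is_derive t 1 F (f t).

End RealFunctions.

Lemma upper_half_spaceE (R : realType) (n : nat) :
  upper_half_space R n = half_space (e_last R n) 0.
Proof.
apply/seteqP; split => x; rewrite /upper_half_space /half_space /= /dot subr0;
  rewrite (bigD1 ord_max) //= big1 ?addr0 => [|i ni];
  by rewrite !mxE ?eqxx ?mul1r ?(negbTE ni) ?mul0r.
Qed.

(* Main.v *)
Require Import Defs.
From HB Require Import structures.
From mathcomp Require Import all_boot all_order all_algebra.
From mathcomp Require Import all_classical all_reals all_analysis.
From mathcomp Require Import ring lra.

Set Implicit Arguments.
Unset Strict Implicit.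
Unset Printing Implicit Defensive.

Import Order.TTheory GRing.Theory Num.Theory.
Import numFieldNormedType.Exports.

Local Open Scope classical_set_scope.
Local Open Scope ring_scope.

(** The proof compares [u] with the one-dimensional solution having the same
    boundary data; all maximum principles are elementary second derivative tests.

    Write [W = sqrt (1 + |grad u|^2)] and let [P = F u + 1 - 1 / W] be the energy.
    On the boundary [grad u] is normal of length [-kappa] ([boundary_gradient]), so
    [P] takes there the constant value [c0 = F 0 + 1 - 1 / sqrt (1 + kappa^2)], and
    the hypothesis on [F 0] says [c0 >= 0].

    Gradient bound: [P <= c0] ([energy_le_boundary]). Where [P > 0], the function
    [P] satisfies an elliptic inequality whose only first order term is
    [grad u . grad P] with a coefficient bounded in terms of [u] and [grad u]
    ([sum_energy_hess_ge]). Since [F <= 0], the gradient of [u] is bounded away from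
    zero there, so [exp (lam u)] is a bounded strict subsolution for large [lam].
    A maximum of [P + eta exp (lam u) - eps |x|^2] can then lie neither inside nor
    on the boundary if [P] exceeds [c0] somewhere. This plays the role of the usual
    passage to a limit of translates of [u].

    Comparison: [F u < c0] everywhere, by a Gronwall argument in the case [c0 = 0]
    ([F_lt_boundary_energy]). A one-dimensional solution [w] with [P = c0] satisfies
    [w' = G w] with [1 / sqrt (1 + G^2) = 1 - c0 + F]. With [Phi' = 1 / G], the bound
    [P <= c0] says that [Phi (u x)] is 1-Lipschitz in [x], so the gap
    [x_n - (Phi (u x) - Phi 0)] is nonnegative, and it vanishes on the boundary
    ([gap_ge0]). Its gradient also vanishes on the boundary, because of the
    overdetermined data, and at interior zeros, which are minima
    ([contact_slope]).

    Rigidity: in terms of the gap the equation has no zero-order term, because all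
    vertical translates of [w] are solutions. If the gap were positive somewhere,
    a ball free of its zeros would touch a zero, inside or on the boundary, and the
    boundary point lemma would give a nonzero slope there. Hence the gap vanishes
    identically ([gap_eq0]), [Phi (u x) - Phi 0] is the height of [x], and [u] is a
    function of the height since [Phi] is increasing on the range of [u]. The
    boundary point lemma is applied to the gap rather than to [P]: the gradient of
    the gap extends continuously to the boundary, that of [P] involves second
    derivatives of [u], about which nothing is assumed there. *)

(** * Differentiation along lines *)

Section Lines.
Context {R : realType} {V : normedModType R}.
Implicit Types (f g : V -> R) (x v : V) (t : R).

(** Directional derivatives are derivatives along lines, which makes the
    one-variable theory (chain rule, mean value theorem) available. *)
Lemma is_derive_lineP g x v t d :
  is_derive (x + t *: v) v g d <->
  is_derive t 1 (fun s : R => g (x + s *: v)) d.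
Proof.
have E : (fun h : R => h^-1 *: (g (h *: v + (x + t *: v)) - g (x + t *: v))) =
  (fun h : R => h^-1 *: (((fun s : R => g (x + s *: v)) \o shift t) (h *: 1)
       - g (x + t *: v))).
  apply/funext => h /=; congr (_ *: (g _ - _)).
  by rewrite [h%:A]mulr1 scalerDl addrCA.
by split; case => h1 h2; split;
   rewrite /derivable /derive in h1 h2 *; first [rewrite -E|rewrite E].
Qed.

Lemma is_derive_line0P g x v d :
  is_derive x v g d <-> is_derive (0 : R) 1 (fun s : R => g (x + s *: v)) d.
Proof. by rewrite -is_derive_lineP scale0r addr0. Qed.

Lemma is_derive_comp g x v (phi : R -> R) d e :
  is_derive (g x) 1 phi e -> is_derive x v g d ->
  is_derive x v (fun y => phi (g y)) (e * d).
Proof.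
move=> dphi /is_derive_line0P dg; apply/is_derive_line0P.
apply: (@is_derive1_comp _ phi (fun s : R => g (x + s *: v))).
by rewrite scale0r addr0.
Qed.

Lemma is_derive_add f g x v a b :
  is_derive x v f a -> is_derive x v g b ->
  is_derive x v (fun y => f y + g y) (a + b).
Proof. by move=> *; exact: is_deriveD. Qed.

Lemma is_derive_sub f g x v a b :
  is_derive x v f a -> is_derive x v g b ->
  is_derive x v (fun y => f y - g y) (a - b).
Proof. by move=> *; exact: is_deriveB. Qed.

Lemma is_derive_mul f g x v a b :
  is_derive x v f a -> is_derive x v g b ->
  is_derive x v (fun y => f y * g y) (a * g x + f x * b).
Proof.
move=> fa gb.
by apply: (is_derive_eq (is_deriveM fa gb)); rewrite addrC mulrC.
Qed.

Lemma is_derive_const x v (c : R) : is_derive x v (fun=> c) 0.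
Proof. exact: is_derive_cst. Qed.

Lemma is_derive_bigsum n (h : 'I_n -> V -> R) (dh : 'I_n -> R) x v :
  (forall i, is_derive x v (h i) (dh i)) ->
  is_derive x v (fun y => \sum_(i < n) h i y) (\sum_(i < n) dh i).
Proof.
move=> dhi; have := is_derive_sum dhi.
by congr is_derive; apply/funext => y; rewrite fct_sumE.
Qed.

End Lines.

Lemma is_derive_lin (R : realType) (t a b : R) : is_derive t 1 (fun s : R => a + s * b) b.
Proof.
have := is_derive_add (@is_derive_cst _ _ _ a t 1)
  (is_derive_mul (@is_derive_id _ _ t 1) (@is_derive_cst _ _ _ b t 1)).
by rewrite mul1r mulr0 addr0 add0r.
Qed.

Section Segments.
Context {R : realType} {V : normedModType R}.
Implicit Types (g : V -> R) (x v : V) (t : R).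

Lemma is_derive_scaled g x v t d :
  is_derive x v g d -> is_derive x (t *: v) g (t * d).
Proof.
move=> /is_derive_line0P dg; apply/is_derive_line0P.
have := @is_derive1_comp _ (fun s : R => g (x + s *: v)) (fun s => 0 + s * t) 0 d t.
rewrite mul0r addr0 => /(_ dg (is_derive_lin 0 0 t)).
rewrite mulrC; congr is_derive; apply/funext => s /=.
by rewrite add0r scalerA.
Qed.

Lemma line_MVT g x v (dg : R -> R) :
  {within `[0, 1], continuous (fun s : R => g (x + s *: v))} ->
  (forall s : R, s \in `]0, 1[ -> is_derive (x + s *: v) v g (dg s)) ->
  exists2 s : R, s \in `]0, 1[ & g (x + v) - g x = dg s.
Proof.
move=> cg dgP.
have [|s s01] := @MVT R (fun s => g (x + s *: v)) dg 0 1 (@ltr01 R) _ cg.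
  by move=> s /dgP /is_derive_lineP.
by rewrite scale1r scale0r addr0 subr0 mulr1 => ->; exists s.
Qed.

End Segments.

(** * Continuous partial derivatives *)

Section ContinuousPartials.
Context {R : realType} {n : nat}.
Notation V := 'rV[R]_n.
Implicit Types (f g : V -> R) (A : set V) (x v w : V).

Lemma nbhs_normP x (P : set V) :
  nbhs x P <-> exists2 r : R, 0 < r & forall y, `|y - x| < r -> P y.
Proof.
split=> [/nbhs_ballP[r r0 rP]|[r r0 rP]].
  by exists r => // y xy; apply: rP; rewrite -ball_normE /= distrC.
by apply/nbhs_ballP; exists r => // y; rewrite -ball_normE /= distrC => /rP.
Qed.

Lemma norm_segment x w z (s r : R) : `|w| + `|z| < r ->
  s \in `[0, 1] -> `|x + w + s *: z - x| < r.
Proof.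
rewrite in_itv /= => wzr /andP[s0 s1].
rewrite -(addrA x) (addrC x) addrK; apply: (le_lt_trans (ler_normD _ _)).
apply: le_lt_trans wzr; rewrite lerD2l normrZ ger0_norm//.
by rewrite ler_piMl.
Qed.

(** The last coordinate step of a path has the expected growth rate even though
    its base point moves: the mean value theorem on the step only uses the
    continuity of the partial derivative at the limit point. *)
Lemma partial_moving_base f x w (c : R) (i : 'I_n) :
  (\forall y \near x, {for y, continuous f} /\ derivable f y (basis_vec i)) ->
  {for x, continuous (partial i f)} ->
  h^-1 * (f (x + h *: w + (h * c) *: basis_vec i) - f (x + h *: w))
    @[h --> 0^'] --> c * partial i f x.
Proof.
move=> fx dfx; apply/cvgrPdist_lt => e e0.
pose e' := e / (`|c| + 1).
have e'0 : 0 < e' by rewrite divr_gt0// ltr_wpDl.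
have /nbhs_normP[r r0 rP] : \forall y \near x,
    ({for y, continuous f} /\ derivable f y (basis_vec i)) /\
    `|partial i f x - partial i f y| < e'.
  near=> y; split; [by near: y|near: y].
  by move/cvgrPdist_lt : dfx; exact.
pose K := `|w| + `|c| * `|basis_vec i : V| + 1.
have K0 : 0 < K by rewrite ltr_wpDl// addr_ge0// mulr_ge0.
near=> h.
have h0 : h != 0 by near: h; exact: nbhs_dnbhs_neq.
have hK : `|h *: w| + `|(h * c) *: (basis_vec i : V)| < r.
  have : `|h| < r / K.
    by near: h; apply: dnbhs0_lt; rewrite divr_gt0.
  rewrite ltr_pdivlMr// => /(le_lt_trans _); apply.
  by rewrite !normrZ ?normrM -mulrA -mulrDr ler_wpM2l// lerDl.
have [|s s01|s s01 ->] := @line_MVT R V f (x + h *: w)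
    ((h * c) *: basis_vec i)
    (fun s => (h * c) * partial i f (x + h *: w + s *: ((h * c) *: basis_vec i))).
- apply: continuous_in_subspaceT => s /set_mem s01.
  have [[fs _] _] := rP _ (norm_segment x hK s01).
  apply: (@continuous_comp R V R (fun s => x + h *: w + s *: ((h * c) *: basis_vec i)) f) => //.
  by apply: cvgD; [exact: cvg_cst|exact: scalel_continuous].
- have [|[_ ds] _] := rP (x + h *: w + s *: ((h * c) *: basis_vec i)).
    by apply: norm_segment => //; exact: subset_itv_oo_cc s01.
  by apply: is_derive_scaled; exact: DeriveDef.
- have /rP[_] := norm_segment x hK (subset_itv_oo_cc s01).
  set D := partial i f (_ + _) => Dx.
  rewrite !mulrA mulVf// mul1r -mulrBr normrM.
  apply: (@le_lt_trans _ _ ((`|c| + 1) * `|partial i f x - D|)).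
    by rewrite ler_wpM2r// lerDl.
  by rewrite mulrC -ltr_pdivlMr// ltr_wpDl.
Unshelve. all: by end_near. Qed.

Lemma Ck_continuous k A f x : Ck k A f -> A x -> {for x, continuous f}.
Proof. by case: k => [|k] [h _]; exact: h. Qed.

Lemma Ck_partial k A f i : Ck k.+1 A f -> Ck k A (partial i f).
Proof. by case=> _ /(_ i)[]. Qed.

Lemma Ck_derivable k A f x i : Ck k.+1 A f -> A x ->
  derivable f x (basis_vec i).
Proof. by case=> _ /(_ i)[h _]; exact: h. Qed.

Lemma CkW k A f : Ck k.+1 A f -> Ck k A f.
Proof.
elim: k f => [|k IH] f [fc fk]; split => // i.
by have [df pf] := fk i; split => //; exact: IH.
Qed.

(** Induction on the coordinates: the increment along [v] is a sum of increments
    parallel to the axes, one for each coordinate of [v]. *)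
Lemma C1_is_derive A f x v : open A -> Ck 1 A f -> A x ->
  is_derive x v f (dot v (grad f x)).
Proof.
move=> oA f1 Ax.
pose w (s : seq 'I_n) : V := \sum_(i <- s) v 0 i *: basis_vec i.
have fw (s : seq 'I_n) : h^-1 * (f (x + h *: w s) - f x) @[h --> 0^'] -->
    \sum_(i <- s) v 0 i * partial i f x.
  elim: s => [|i s IH].
    rewrite big_nil (_ : (fun _ => _) = cst 0); first exact: cvg_cst.
    by apply/funext => h; rewrite /w big_nil scaler0 addr0 subrr mulr0.
  rewrite big_cons (_ : (fun _ => _) = (fun h : R =>
      h^-1 * (f (x + h *: w s + (h * v 0 i) *: basis_vec i) - f (x + h *: w s)) +
      h^-1 * (f (x + h *: w s) - f x))).
    apply: cvgD IH; apply: partial_moving_base.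
    - near=> y; have Ay : A y by near: y; exact: open_nbhs_nbhs.
      by split; [exact: Ck_continuous f1 Ay|exact: Ck_derivable f1 Ay].
    - exact: (Ck_continuous (Ck_partial i f1)).
  apply/funext => h.
  rewrite -mulrDr addrA subrK /w big_cons; congr (_ * (f _ - _)).
  by rewrite scalerDr scalerA addrCA addrC.
have wE : w (index_enum 'I_n) = v.
  by rewrite /w /basis_vec -row_sum_delta.
have := fw (index_enum 'I_n); rewrite wE.
have -> : \sum_(i <- index_enum 'I_n) v 0 i * partial i f x = dot v (grad f x).
  by apply: eq_bigr => i _; rewrite mxE.
have E : (fun h : R => h^-1 * (f (x + h *: v) - f x)) =
         (fun h : R => h^-1 *: (f (h *: v + x) - f x)).
  by apply/funext => h; rewrite [x + _]addrC.
rewrite E => fl; apply: DeriveDef; first by apply/cvg_ex; exists (dot v (grad f x)).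
exact/cvg_lim.
Unshelve. all: by end_near. Qed.

End ContinuousPartials.

Section LineTests.
Context {R : realType} {V : normedModType R}.
Implicit Types (g : V -> R) (x v w : V).

Lemma is_derive_translate g x v w d :
  is_derive (x + w) v g d -> is_derive x v (fun y => g (y + w)) d.
Proof.
move=> /is_derive_line0P dg; apply/is_derive_line0P.
by move: dg; congr is_derive; apply/funext => s; rewrite addrAC.
Qed.

Lemma is_derive_continuous (phi : R -> R) (t d : R) :
  is_derive t 1 phi d -> {for t, continuous phi}.
Proof. by move=> [dphi _]; apply/differentiable_continuous/derivable1_diffP. Qed.

Lemma line_MVT_derive g x v (dg : R -> R) :
  (forall s : R, s \in `[0, 1] -> is_derive (x + s *: v) v g (dg s)) ->
  exists2 s : R, s \in `]0, 1[ & g (x + v) - g x = dg s.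
Proof.
move=> dgP.
have dgo (s : R) : s \in `]0, 1[ -> is_derive (x + s *: v) v g (dg s).
  by move=> s01; apply: dgP; exact: subset_itv_oo_cc s01.
have cg : {within `[0, 1], continuous (fun s : R => g (x + s *: v))}.
  apply: continuous_in_subspaceT => s /set_mem s01.
  have /is_derive_lineP ds := dgP s s01.
  exact: is_derive_continuous ds.
exact: line_MVT cg dgo.
Qed.

Lemma line_cvg0 x v : x + s *: v @[s --> (0 : R)] --> x.
Proof.
rewrite -[X in _ --> X]addr0 -[X in _ --> _ + X](scale0r v).
by apply: cvgD; [exact: cvg_cst|exact: scalel_continuous].
Qed.

Lemma near_line x (P : set V) v :
  (\forall y \near x, P y) -> \forall s \near (0 : R), P (x + s *: v).
Proof. by move=> Px; have := @line_cvg0 x v P Px. Qed.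

Lemma first_derivative_at_max (phi dphi : R -> R) :
  (\forall t \near (0 : R), phi t <= phi 0) ->
  (\forall t \near (0 : R), is_derive (t : R) 1 phi (dphi t)) -> dphi 0 = 0.
Proof.
move=> pmax dphiP.
have /nbhs_ballP[r r0 rP] : \forall t \near (0 : R),
    phi t <= phi 0 /\ is_derive (t : R) 1 phi (dphi t).
  by near=> t; split; [near: t|near: t].
have inr (t : R) : t \in `]- r, r[ -> ball 0 r t.
  by rewrite in_itv /= -ball_normE /= sub0r normrN ltr_norml.
have r0' : (0 : R) \in `]- r, r[ by rewrite in_itv /= oppr_lt0 r0.
have Nrr : - r <= r by apply: ltW; rewrite (lt_trans _ r0)// oppr_lt0.
have dpr (t : R) : t \in `]- r, r[ -> derivable phi t 1 by move=> /inr/rP[_ []].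
have pmax' (t : R) : t \in `]- r, r[ -> phi t <= phi 0 by move=> /inr/rP[].
have [_ e0] := derive1_at_max Nrr dpr r0' pmax'.
by have [_ [_ <-]] := rP 0 (inr _ r0').
Unshelve. all: by end_near. Qed.

(** A positive second derivative would make the first derivative positive just
    after [0], against the maximum. *)
Lemma second_derivative_at_max (phi dphi : R -> R) (d2 : R) :
  (\forall t \near (0 : R), phi t <= phi 0) ->
  (\forall t \near (0 : R), is_derive (t : R) 1 phi (dphi t)) ->
  is_derive (0 : R) 1 dphi d2 -> dphi 0 = 0 /\ d2 <= 0.
Proof.
move=> pmax dphiP d2P; have dphi0 := first_derivative_at_max pmax dphiP.
have [r r0 rP] : exists2 r : R, 0 < r & forall t, `|t| < r ->
    phi t <= phi 0 /\ is_derive (t : R) 1 phi (dphi t).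
  have /nbhs_ballP[r r0 rP] : \forall t \near (0 : R),
    phi t <= phi 0 /\ is_derive (t : R) 1 phi (dphi t).
    by near=> t; split; [near: t|near: t].
  by exists r => // t tr; apply: rP; rewrite -ball_normE /= sub0r normrN.
split=> //; rewrite leNgt; apply/negP => d20.
have [t t0 tP] : exists2 t : R, 0 < t & forall s, 0 < s < t -> 0 < dphi s.
  have [dd dv] := d2P.
  have : (fun h : R => h^-1 *: (dphi (h *: 1 + 0) - dphi 0)) @ 0^' --> d2.
    by rewrite -dv; exact: dd.
  move=> /cvgrPdist_lt /(_ _ d20); rewrite near_withinE => /nbhs_ballP[t t0 tP].
  exists t => // s /andP[s0 st]; have := tP s.
  rewrite -ball_normE /= sub0r normrN gtr0_norm// => /(_ st (lt0r_neq0 s0)).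
  rewrite dphi0 subr0 addr0 [s%:A]mulr1 ltr_norml => /andP[_].
  rewrite ltrBlDr ltrDl pmulr_rgt0 ?invr_gt0//.
pose b := Num.min (r / 2) (t / 2).
have b0 : 0 < b by rewrite lt_min !divr_gt0.
have br : b < r by rewrite gt_min ltr_pdivrMr// ltr_pMr// ltr1n.
have bt : b < t by rewrite gt_min [t / 2 < t]ltr_pdivrMr// ltr_pMr// ltr1n orbT.
have [||s] := @MVT R phi dphi 0 b b0.
- move=> s; rewrite in_itv/= => /andP[s0 sb].
  by have [|] := rP s => //; rewrite gtr0_norm// (lt_trans sb).
- apply: continuous_in_subspaceT => s /set_mem/=; rewrite in_itv/= => /andP[s0 sb].
  by have [|_ /is_derive_continuous] := rP s => //; rewrite ger0_norm// (le_lt_trans sb).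
rewrite in_itv/= => /andP[s0 sb] E.
have [|+ _] := rP b; first by rewrite gtr0_norm.
rewrite -subr_le0 E subr0 leNgt => /negP; apply.
by rewrite mulr_gt0// tP// s0 (lt_trans sb).
Unshelve. all: by end_near. Qed.

Lemma line_first_derivative_at_max g x v (dg : V -> R) :
  (\forall y \near x, g y <= g x) ->
  (\forall y \near x, is_derive y v g (dg y)) -> dg x = 0.
Proof.
move=> gmax dgP.
have := @first_derivative_at_max (fun s => g (x + s *: v)) (fun s => dg (x + s *: v)).
rewrite scale0r addr0; apply => //.
  exact: (@near_line x (fun y => g y <= g x)).
have := @near_line x _ v dgP.
by apply: filterS => s /is_derive_lineP.
Qed.

Lemma line_second_derivative_at_max g x v (dg : V -> R) (d2 : R) :
  (\forall y \near x, g y <= g x) ->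
  (\forall y \near x, is_derive y v g (dg y)) ->
  is_derive x v dg d2 -> dg x = 0 /\ d2 <= 0.
Proof.
move=> gmax dgP /is_derive_line0P d2P.
have := @second_derivative_at_max (fun s => g (x + s *: v))
   (fun s => dg (x + s *: v)) d2.
rewrite scale0r addr0; apply => //.
  exact: (@near_line x (fun y => g y <= g x)).
have := @near_line x _ v dgP.
by apply: filterS => s /is_derive_lineP.
Qed.

End LineTests.

(** * Symmetry of second derivatives *)

Section Schwarz.
Context {R : realType} {n : nat}.
Notation V := 'rV[R]_n.
Implicit Types (f g : V -> R) (A : set V) (x v w : V).

Lemma partial_is_derive f x i : derivable f x (basis_vec i) ->
  is_derive x (basis_vec i) f (partial i f x).
Proof. by move=> fx; exact: DeriveDef. Qed.

(** Two applications of the mean value theorem; performing them in the other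
    order produces the other mixed derivative of the same second difference. *)
Lemma mixed_difference A f x (r h : R) i j : open A -> Ck 2 A f ->
  (forall y, `|y - x| < r -> A y) -> 
  `|h *: (basis_vec i : V)| + `|h *: (basis_vec j : V)| < r ->
  exists y d, [/\ `|y - x| < r, d = partial j (partial i f) y &
    f (x + h *: basis_vec i + h *: basis_vec j) - f (x + h *: basis_vec i)
    - (f (x + h *: basis_vec j) - f x) = h * (h * d)].
Proof.
move=> oA f2 rA hr.
have f1 : Ck 1 A f by exact: CkW.
have seg (s t : R) : s \in `[0, 1] -> t \in `[0, 1] ->
    `|x + s *: (h *: basis_vec i) + t *: (h *: basis_vec j) - x| < r.
  move=> s01 t01; apply: norm_segment => //; apply: le_lt_trans hr.
  rewrite lerD2r normrZ ger0_norm ?ler_piMl//; first by case/andP: s01.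
  by case/andP: s01.
have O01 : (0 : R) \in `[0, 1] by rewrite in_itv/= lexx ler01.
have l01 : (1 : R) \in `[0, 1] by rewrite in_itv/= lexx ler01.
have [|s s01 ->] := @line_MVT_derive R V (fun y => f (y + h *: basis_vec j) - f y)
   x (h *: basis_vec i) (fun s => h * (partial i f (x + s *: (h *: basis_vec i) +
   h *: basis_vec j) - partial i f (x + s *: (h *: basis_vec i)))).
  move=> s s01; apply: is_derive_scaled; apply: is_derive_sub.
    apply: is_derive_translate; apply: partial_is_derive; apply: (Ck_derivable f1).
    by apply: rA; rewrite -[X in _ + X - _]scale1r; exact: seg.
  apply: partial_is_derive; apply: (Ck_derivable f1).
  by apply: rA; have := seg _ _ s01 O01; rewrite scale0r addr0.
have s01' := subset_itv_oo_cc s01.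
have [|t t01 ->] := @line_MVT_derive R V (partial i f)
   (x + s *: (h *: basis_vec i)) (h *: basis_vec j)
   (fun t => h * partial j (partial i f) (x + s *: (h *: basis_vec i) + t *: (h *: basis_vec j))).
  move=> t t01; apply: is_derive_scaled; apply: partial_is_derive.
  by apply: (Ck_derivable (Ck_partial i f2)); apply: rA; exact: seg.
do 2 eexists; split; [|reflexivity|reflexivity].
by apply: seg => //; exact: subset_itv_oo_cc.
Qed.

Lemma second_difference_sym f x v w :
  f (x + v + w) - f (x + v) - (f (x + w) - f x) =
  f (x + w + v) - f (x + w) - (f (x + v) - f x).
Proof.
have swap (p q s t : R) : p - q - (s - t) = p - s - (q - t) by ring.
by rewrite (addrAC x v w); exact: swap.
Qed.

Lemma Schwarz A f x i j : open A -> Ck 2 A f -> A x ->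
  partial i (partial j f) x = partial j (partial i f) x.
Proof.
move=> oA f2 Ax; apply/eqP; rewrite -subr_eq0 -normr_le0; apply/ler_addgt0Pl => e e0.
have e20 : 0 < e / 2 by rewrite divr_gt0.
have c k l : \forall y \near x,
    `|partial k (partial l f) x - partial k (partial l f) y| < e / 2.
  have := Ck_continuous (Ck_partial k (Ck_partial l f2)) Ax.
  by move=> /cvgrPdist_lt; exact.
have [cij cji] := (c i j, c j i).
have /nbhs_normP[r r0 rP] : \forall y \near x, A y /\
    (`|partial i (partial j f) x - partial i (partial j f) y| < e / 2 /\
    `|partial j (partial i f) x - partial j (partial i f) y| < e / 2).
  exact: (filterI (open_nbhs_nbhs (conj oA Ax)) (filterI cij cji)).
pose K := `|basis_vec i : V| + `|basis_vec j : V| + 1.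
have K0 : 0 < K by rewrite ltr_wpDl// addr_ge0.
have [h h0 hK] : exists2 h : R, 0 < h & h * K < r.
  exists (r / 2 / K); first by rewrite !divr_gt0.
  by rewrite divfK ?gt_eqF// ltr_pdivrMr// ltr_pMr// ltr1n.
have hr : `|h *: (basis_vec i : V)| + `|h *: (basis_vec j : V)| < r.
  apply: le_lt_trans hK; rewrite !normrZ -mulrDr (gtr0_norm h0).
  by rewrite ler_wpM2l ?ltW// ltrDl.
have rA y : `|y - x| < r -> A y by move=> /rP[].
have [y [d [/rP[_ [_ yi]] dE Ey]]] := mixed_difference oA f2 rA hr.
rewrite addrC in hr.
have [z [d' [/rP[_ [zj _]] dE' Ez]]] := mixed_difference oA f2 rA hr.
have dd' : d = d'.
  apply: (mulfI (lt0r_neq0 h0)); apply: (mulfI (lt0r_neq0 h0)).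
  by rewrite -Ey -Ez; exact: second_difference_sym.
rewrite -dE in yi; rewrite -dE' -dd' in zj; rewrite addr0.
apply: (le_trans (ler_distD d _ _)).
rewrite [e]splitr; apply: lerD; first exact: ltW zj.
by rewrite distrC; exact: ltW yi.
Qed.

End Schwarz.

(** * Euclidean algebra *)

Section Euclid.
Context {R : realType} {n : nat}.
Notation V := 'rV[R]_n.
Implicit Types (x y v w p q r : V) (H A : 'M[R]_n) (a b c : R).

Lemma dotC x y : dot x y = dot y x.
Proof. by apply: eq_bigr => i _; rewrite mulrC. Qed.

Lemma dotDl x y z : dot (x + y) z = dot x z + dot y z.
Proof. by rewrite -big_split; apply: eq_bigr => i _; rewrite mxE mulrDl. Qed.

Lemma dotZl a x z : dot (a *: x) z = a * dot x z.
Proof. by rewrite mulr_sumr; apply: eq_bigr => i _; rewrite mxE mulrA. Qed.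

Lemma dotNl x z : dot (- x) z = - dot x z.
Proof. by rewrite -scaleN1r dotZl mulN1r. Qed.

Lemma dotBl x y z : dot (x - y) z = dot x z - dot y z.
Proof. by rewrite dotDl dotNl. Qed.

Lemma dotDr x y z : dot x (y + z) = dot x y + dot x z.
Proof. by rewrite dotC dotDl !(dotC x). Qed.

Lemma dotZr a x z : dot x (a *: z) = a * dot x z.
Proof. by rewrite dotC dotZl (dotC x). Qed.

Lemma dotNr x z : dot x (- z) = - dot x z.
Proof. by rewrite dotC dotNl (dotC x). Qed.

Lemma dotBr x y z : dot x (y - z) = dot x y - dot x z.
Proof. by rewrite dotDr dotNr. Qed.

Lemma dot_sub_sqr x y : dot (x - y) (x - y) = dot x x - 2 * dot x y + dot y y.
Proof. by rewrite !(dotBl, dotBr) (dotC y x); ring. Qed.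

Lemma dot_basis i x : dot (basis_vec i) x = x 0 i.
Proof.
rewrite /dot (bigD1 i) //= big1 ?addr0 => [|j ji]; first by rewrite mxE !eqxx mul1r.
by rewrite mxE (negbTE ji) andbF mul0r.
Qed.

Lemma dotxx_ge0 x : 0 <= dot x x.
Proof. by apply: sumr_ge0 => i _; rewrite -expr2 sqr_ge0. Qed.

Lemma dotxx_eq0 x : (dot x x == 0) = (x == 0).
Proof.
apply/eqP/eqP => [x0|->]; last by rewrite /dot big1// => i _; rewrite mxE mul0r.
apply/rowP => i; rewrite mxE; apply/eqP.
by move: x0 => /psumr_eq0P => /(_ _ i isT)/eqP; rewrite mulf_eq0 orbb; apply=> j _;
  rewrite -expr2 sqr_ge0.
Qed.

Lemma enorm_sqr x : enorm x ^+ 2 = dot x x.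
Proof. by rewrite sqr_sqrtr// dotxx_ge0. Qed.

Lemma CauchySchwarz x y : dot x y ^+ 2 <= dot x x * dot y y.
Proof.
have [/eqP|y0] := boolP (dot y y == 0).
  move=> /eqP; rewrite dotxx_eq0 => /eqP ->.
  by rewrite -(scale0r 0) !dotZr !mul0r expr0n mulr0.
have yp : 0 < dot y y by rewrite lt_def y0 dotxx_ge0.
have := dotxx_ge0 (dot y y *: x - dot x y *: y).
rewrite !(dotBl, dotBr, dotZl, dotZr) (dotC y x).
set a := dot x x; set b := dot x y; set c := dot y y in yp *.
have -> : c * (c * a - b * b) - b * (c * b - b * c) = c * (a * c - b ^+ 2) by ring.
by rewrite pmulr_rge0// subr_ge0.
Qed.

Lemma sum_coord_sqr x : \sum_(i < n) x 0 i ^+ 2 = dot x x.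
Proof. by apply: eq_bigr => i _; rewrite expr2. Qed.

Lemma coord_sqr_le x i : x 0 i ^+ 2 <= dot x x.
Proof.
rewrite -sum_coord_sqr (bigD1 i) //= lerDl; apply: sumr_ge0 => j _; exact: sqr_ge0.
Qed.

Definition bil H v w : R := dot w (v *m H).
Notation quad H v := (bil H v v).

Lemma bilDl H v w y : bil H (v + w) y = bil H v y + bil H w y.
Proof. by rewrite /bil mulmxDl dotDr. Qed.

Lemma bilZl H a v y : bil H (a *: v) y = a * bil H v y.
Proof. by rewrite /bil -scalemxAl dotZr. Qed.

Lemma bilDr H v w y : bil H y (v + w) = bil H y v + bil H y w.
Proof. by rewrite /bil dotDl. Qed.

Lemma bilZr H a v y : bil H y (a *: v) = a * bil H y v.
Proof. by rewrite /bil dotZl. Qed.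

Lemma bilD H A v w : bil (H + A) v w = bil H v w + bil A v w.
Proof. by rewrite /bil mulmxDr dotDr. Qed.

Lemma bilZ a H v w : bil (a *: H) v w = a * bil H v w.
Proof. by rewrite /bil -scalemxAr dotZr. Qed.

Lemma bil_outer q v w : bil (q^T *m q) v w = dot v q * dot w q.
Proof.
rewrite /bil mulmxA; have -> : v *m q^T *m q = dot v q *: q.
  apply/rowP => i; rewrite !mxE big_ord1 !mxE; congr (_ * _).
  by apply: eq_bigr => j _; rewrite mxE.
by rewrite dotZr.
Qed.

Lemma bil_basis H i v : bil H (basis_vec i) v = dot v (row i H).
Proof. by rewrite /bil /basis_vec -rowE. Qed.

Lemma quad_basis H i : quad H (basis_vec i) = H i i.
Proof. by rewrite bil_basis dot_basis mxE. Qed.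

Lemma row_basis_sum v : v = \sum_(i < n) v 0 i *: basis_vec i.
Proof. exact: row_sum_delta. Qed.

Lemma bil_suml (F : 'I_n -> V) H v :
  bil H (\sum_(i < n) F i) v = \sum_(i < n) bil H (F i) v.
Proof.
by elim/big_ind2: _ => [|x a y b <- <-|//]; rewrite ?bilDl // -(scale0r 0) bilZl mul0r.
Qed.

Lemma bil_sumr (F : 'I_n -> V) H v :
  bil H v (\sum_(i < n) F i) = \sum_(i < n) bil H v (F i).
Proof.
by elim/big_ind2: _ => [|x a y b <- <-|//]; rewrite ?bilDr // -(scale0r 0) bilZr mul0r.
Qed.

(** The vectors below are the columns of the symmetric square root of the
    principal coefficient matrix [1 - p p^T / (1 + |p|^2)] of the mean curvature
    operator, so that a trace against this matrix is a plain sum of second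
    derivatives in these directions. *)
Definition mc_frame p (k : 'I_n) : V :=
  let W := Num.sqrt (1 + dot p p) in
  basis_vec k - (p 0 k / (W * (W + 1))) *: p.

Lemma sum_quad_mc_frame H p :
  \sum_(k < n) quad H (mc_frame p k) = \tr H - quad H p / (1 + dot p p).
Proof.
rewrite /mc_frame; set N := dot p p; set W := Num.sqrt _.
have N0 : 0 <= N := dotxx_ge0 p.
have W2 : W ^+ 2 = 1 + N by rewrite sqr_sqrtr// addr_ge0.
have W0 : 0 < W by rewrite sqrtr_gt0 ltr_wpDr.
set c := W * (W + 1).
have E k : quad H (basis_vec k - (p 0 k / c) *: p) = H k k
    - c^-1 * (bil H (p 0 k *: basis_vec k) p + bil H p (p 0 k *: basis_vec k))
    + c^-1 ^+ 2 * quad H p * (p 0 k * p 0 k).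
  by rewrite -scaleNr !(bilDl, bilDr, bilZl, bilZr) quad_basis; ring.
under eq_bigr => k _ do rewrite E.
rewrite !big_split/= sumrN -!mulr_sumr big_split/= -bil_suml -bil_sumr.
rewrite -row_basis_sum -/(dot p p) -/N -/(\tr H).
have -> : N = W ^+ 2 - 1 by rewrite W2 addrC addKr.
rewrite /c; field.
by rewrite (addrC 1) subrK !gt_eqF// ?addr_gt0// exprn_gt0.
Qed.

(** Splitting off the [p]-row and [p]-column of a symmetric matrix: the
    mixed entries are counted twice in the Frobenius norm. *)
Lemma frobenius_ge A p : A^T = A -> 0 < dot p p ->
  2 * dot (p *m A) (p *m A) * dot p p - dot p (p *m A) ^+ 2 <=
    (\sum_(i < n) \sum_(j < n) A i j ^+ 2) * dot p p ^+ 2.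
Proof.
move=> At N0; set q := p *m A; set N := dot p p in N0 *; set X := dot p q; set Y := dot q q.
set Z := \sum_(i < n) _.
pose r := N^-1 *: q - (X / (2 * N ^+ 2)) *: p.
have qE i : q 0 i = \sum_(j < n) A i j * p 0 j.
  by rewrite mxE; apply: eq_bigr => j _; rewrite mulrC -{1}At mxE.
have : 0 <= \sum_(i < n) \sum_(j < n) (A i j - r 0 i * p 0 j - p 0 i * r 0 j) ^+ 2.
  by apply: sumr_ge0 => i _; apply: sumr_ge0 => j _; rewrite sqr_ge0.
have qE' j : q 0 j = \sum_(i < n) A i j * p 0 i.
  by rewrite mxE; apply: eq_bigr => i _; rewrite mulrC.
have -> : \sum_(i < n) \sum_(j < n) (A i j - r 0 i * p 0 j - p 0 i * r 0 j) ^+ 2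
    = Z - 4 * dot r q + 2 * dot r r * N + 2 * dot r p ^+ 2.
  have E i j : (A i j - r 0 i * p 0 j - p 0 i * r 0 j) ^+ 2 =
     A i j ^+ 2 + (- 2) * (r 0 i * (A i j * p 0 j)) + (- 2) * (r 0 j * (A i j * p 0 i))
     + (r 0 i * r 0 i) * (p 0 j * p 0 j) + (p 0 i * p 0 i) * (r 0 j * r 0 j)
     + 2 * ((r 0 i * p 0 i) * (r 0 j * p 0 j)) by ring.
  under eq_bigr => i _ do (under eq_bigr => j _ do rewrite E;
    rewrite !big_split/= -!mulr_sumr -/(dot p p) -/(dot r r) -/(dot r p)
     -qE).
  rewrite !big_split/= -!mulr_sumr -!mulr_suml -/(dot r q) -/(dot p p) -/(dot r r) -/(dot r p).
  have -> : \sum_(i < n) \sum_(j < n) r 0 j * (A i j * p 0 i) = dot r q.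
    by rewrite exchange_big; apply: eq_bigr => j _; rewrite -mulr_sumr -qE'.
  rewrite -/Z -/N; ring.
have NE : N != 0 by rewrite gt_eqF.
rewrite /r !(dotBl, dotBr, dotZl, dotZr) (dotC q p) -/X -/Y -/N => h.
rewrite -subr_ge0; apply: le_trans (mulr_ge0 h (ltW (exprn_gt0 2 N0))) _.
rewrite le_eqVlt; apply/orP; left; apply/eqP; field.
exact: NE.
Qed.

End Euclid.
Notation quad H v := (bil H v v).

Section RealDerivatives.
Context {R : realType}.
Implicit Types t : R.

Lemma is_derive_sqrt1p t : 0 <= t ->
  is_derive t 1 (fun s : R => Num.sqrt (1 + s)) (2 * Num.sqrt (1 + t))^-1.
Proof.
move=> t0; have t1 : 0 < 1 + t by rewrite ltr_wpDr.
have d1 : is_derive t 1 (fun s : R => 1 + s) 1.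
  by have := is_derive_lin t 1 1; under eq_fun do rewrite mulr1.
by have := @is_derive_comp R R (fun s : R => 1 + s) _ _ _ _ _ (is_derive1_sqrt t1) d1;
  rewrite mulr1.
Qed.

Lemma is_derive_inv (V : normedModType R) (g : V -> R) x v d : g x != 0 ->
  is_derive x v g d -> is_derive x v (fun y => (g y)^-1) (- (d / g x ^+ 2)).
Proof.
move=> gx0 dg; apply: DeriveDef.
  by apply: (@derivableV _ _ g) => //; case: dg.
by rewrite (@deriveV _ _ g)// derive_val mulrC; exact: mulNr.
Qed.

Lemma is_derive_cube (V : normedModType R) (g : V -> R) x v d :
  is_derive x v g d -> is_derive x v (fun y => g y ^+ 3) (3 * g x ^+ 2 * d).
Proof.
move=> dg.
have := is_derive_mul dg (is_derive_mul dg dg).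
under eq_fun do rewrite -expr2 -exprS.
by congr is_derive; ring.
Qed.

End RealDerivatives.

(** * Second order calculus of the solution *)

Section Hessian.
Context {R : realType} {n : nat}.
Notation V := 'rV[R]_n.
Implicit Types (u g : V -> R) (x v w : V) (A : set V).

Definition hess g x : 'M[R]_n := \matrix_(i, j) partial i (partial j g) x.

(** The area density of the graph, [sqrt (1 + |grad u|^2)]. *)
Definition area u x : R := Num.sqrt (1 + dot (grad u x) (grad u x)).

Lemma area_gt0 u x : 0 < area u x.
Proof. by rewrite sqrtr_gt0 ltr_wpDr ?dotxx_ge0. Qed.

Lemma area_neq0 u x : area u x != 0.
Proof. by rewrite gt_eqF ?area_gt0. Qed.

Lemma area_sqr u x : area u x ^+ 2 = 1 + dot (grad u x) (grad u x).
Proof. by rewrite sqr_sqrtr// addr_ge0 ?dotxx_ge0. Qed.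

Lemma hess_sym A g x : open A -> Ck 2 A g -> A x -> (hess g x)^T = hess g x.
Proof. by move=> oA g2 Ax; apply/matrixP => i j; rewrite !mxE (Schwarz _ _ oA g2 Ax). Qed.

Lemma grad_partial_hess g x v j : dot v (grad (partial j g) x) = (v *m hess g x) 0 j.
Proof. by rewrite mxE; apply: eq_bigr => i _; rewrite !mxE. Qed.

Lemma is_derive_dot_grad A g x v w : open A -> Ck 2 A g -> A x ->
  is_derive x v (fun y => dot w (grad g y)) (bil (hess g x) v w).
Proof.
move=> oA g2 Ax.
rewrite (_ : (fun y => dot w (grad g y)) = (fun y => \sum_(i < n) w 0 i * partial i g y)).
  apply: is_derive_bigsum => i; rewrite -grad_partial_hess -[w 0 i * _]add0r.
  have := is_derive_mul (is_derive_const x v (w 0 i))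
    (C1_is_derive v oA (Ck_partial i g2) Ax).
  by rewrite mul0r.
by apply/funext => y; apply: eq_bigr => i _; rewrite mxE.
Qed.

Lemma is_derive_grad_sqr A g x v : open A -> Ck 2 A g -> A x ->
  is_derive x v (fun y => dot (grad g y) (grad g y)) (2 * bil (hess g x) v (grad g x)).
Proof.
move=> oA g2 Ax.
rewrite (_ : (fun y => dot (grad g y) (grad g y)) =
             (fun y => \sum_(i < n) partial i g y * partial i g y)); last first.
  by apply/funext => y; apply: eq_bigr => i _; rewrite mxE.
rewrite mulr_sumr; apply: is_derive_bigsum => i.
rewrite -grad_partial_hess mxE.
have d := C1_is_derive v oA (Ck_partial i g2) Ax.
by have := is_derive_mul d d; congr is_derive; ring.
Qed.

Lemma is_derive_area A g x v : open A -> Ck 2 A g -> A x ->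
  is_derive x v (area g) (bil (hess g x) v (grad g x) / area g x).
Proof.
move=> oA g2 Ax.
have := @is_derive_comp R V (fun y => dot (grad g y) (grad g y)) x v
  (fun s => Num.sqrt (1 + s)) _ _ (is_derive_sqrt1p (dotxx_ge0 (grad g x)))
  (is_derive_grad_sqr v oA g2 Ax).
rewrite -/(area g x); congr is_derive; field; exact: area_neq0.
Qed.

Lemma mean_curvatureE A g x : open A -> Ck 2 A g -> A x ->
  mean_curvature_op g x =
  \tr (hess g x) / area g x - quad (hess g x) (grad g x) / area g x ^+ 3.
Proof.
move=> oA g2 Ax; rewrite /mean_curvature_op /divergence.
have E i : partial i (fun y => ((Num.sqrt (1 + enorm (grad g y) ^+ 2))^-1
      *: grad g y) 0 i) x =
    hess g x i i / area g x
    - (grad g x 0 i * bil (hess g x) (basis_vec i) (grad g x)) / area g x ^+ 3.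
  rewrite (_ : (fun y => _) = (fun y => (area g y)^-1 * partial i g y)); last first.
    by apply/funext => y; rewrite !mxE enorm_sqr.
  have di := C1_is_derive (basis_vec i) oA (Ck_partial i g2) Ax.
  have dW := is_derive_area (basis_vec i) oA g2 Ax.
  have [_ dp] := is_derive_mul (is_derive_inv (area_neq0 g x) dW) di.
  rewrite /partial dp dot_basis !mxE -/(partial i g x).
  field; exact: area_neq0.
rewrite (eq_bigr _ (fun i _ => E i)) big_split/= sumrN -!mulr_suml; congr (_ - _ / _).
rewrite [X in bil _ X _](row_basis_sum (grad g x)) bil_suml.
by apply: eq_bigr => i _; rewrite bilZl.
Qed.

End Hessian.

(** * The P-function *)

Section TraceAlgebra.
Context {R : realType} {n : nat}.
Notation V := 'rV[R]_n.
Implicit Types (v w p q : V) (H A : 'M[R]_n).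

Lemma dot_mulmx_tr v w A : dot v (w *m A^T) = dot (v *m A) w.
Proof.
rewrite /dot; under eq_bigr do rewrite mxE mulr_sumr.
rewrite exchange_big /=; apply: eq_bigr => i _; rewrite mxE mulr_suml.
by apply: eq_bigr => j _; rewrite !mxE mulrCA mulrC.
Qed.

Lemma quad_mulmx_tr A v : quad (A *m A^T) v = dot (v *m A) (v *m A).
Proof. by rewrite /bil mulmxA dot_mulmx_tr. Qed.

Lemma quad_1 v : quad 1%:M v = dot v v.
Proof. by rewrite /bil mulmx1. Qed.

Lemma bilN H v w : bil (- H) v w = - bil H v w.
Proof. by rewrite -scaleN1r bilZ mulN1r. Qed.

Lemma trace_outer q : \tr (q^T *m q) = dot q q.
Proof. by apply: eq_bigr => i _; rewrite mxE big_ord1 !mxE. Qed.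

Lemma mxtraceN A : \tr (- A) = - \tr A.
Proof. by rewrite -scaleN1r mxtraceZ mulN1r. Qed.

Lemma trace_mulmx_tr A : \tr (A *m A^T) = \sum_(i < n) \sum_(j < n) A i j ^+ 2.
Proof.
by apply: eq_bigr => i _; rewrite mxE; apply: eq_bigr => j _; rewrite mxE expr2.
Qed.

End TraceAlgebra.

(** The [P]-function inequality in scalar form: [N], [X], [Y], [Z] are
    [|p|^2], [p.Ap], [|Ap|^2], [|A|^2] for the gradient [p] and the Hessian [A],
    and [T], [S] the trace and the [p]-entry of the derivative of [A] along
    [p]; the equation and its derivative along [p] eliminate [t], [T] and [S]. *)
Lemma energy_trace_scalar (R : realType) (N W X Y Z t T S f f' : R) :
  0 < N -> 0 < W -> W ^+ 2 = 1 + N ->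
  W ^+ 2 * t - X + f * W ^+ 3 = 0 ->
  2 * X * t + W ^+ 2 * T - (2 * Y + S) + f' * N * W ^+ 3 + 3 * f * W * X = 0 ->
  2 * Y * N - X ^+ 2 <= Z * N ^+ 2 -> X ^+ 2 <= Y * N ->
  - (f * (N + 2) / (N * W)) * (f * N + X / W ^+ 3) <=
  f' * (N - N ^+ 2 / W ^+ 2) + f * (t - X / W ^+ 2) +
  (W ^+ 3)^-1 * (Z - Y / W ^+ 2 + (T - S / W ^+ 2)) -
  3 / W ^+ 5 * (Y - X ^+ 2 / W ^+ 2).
Proof.
move=> N0 W0 W2 Et ET CZ CY.
have Wn : W != 0 by rewrite gt_eqF.
have NE : N = W ^+ 2 - 1 by rewrite W2 addrC addKr.
have Nn : W ^+ 2 - 1 != 0 by rewrite -NE gt_eqF.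
have tE : t = (X - f * W ^+ 3) / W ^+ 2.
  apply: (mulfI (expf_neq0 2 Wn)); rewrite [RHS]mulrC divfK ?expf_neq0//.
  by apply/eqP; rewrite -subr_eq0 -[X in _ == X]Et; apply/eqP; ring.
have TE : T = (2 * Y + S - 2 * X * t - f' * N * W ^+ 3 - 3 * f * W * X) / W ^+ 2.
  apply: (mulfI (expf_neq0 2 Wn)); rewrite [RHS]mulrC divfK ?expf_neq0//.
  by apply/eqP; rewrite -subr_eq0 -[X in _ == X]ET; apply/eqP; ring.
set g := f * N + X / W ^+ 3.
rewrite -subr_ge0.
have -> : f' * (N - N ^+ 2 / W ^+ 2) + f * (t - X / W ^+ 2) +
    (W ^+ 3)^-1 * (Z - Y / W ^+ 2 + (T - S / W ^+ 2)) -
    3 / W ^+ 5 * (Y - X ^+ 2 / W ^+ 2) - - (f * (N + 2) / (N * W)) * g =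
  (Z * N ^+ 2 - (2 * Y * N - X ^+ 2)) / (N ^+ 2 * W ^+ 3)
  + 2 * (Y * N - X ^+ 2) / (N ^+ 2 * W ^+ 5) + g ^+ 2 / (N ^+ 2 * W).
  by rewrite /g TE tE NE; field; rewrite Nn Wn.
have [N0' W0'] := (ltW N0, ltW W0).
have NW k : 0 <= N ^+ 2 * W ^+ k by rewrite mulr_ge0// exprn_ge0.
apply: addr_ge0; first apply: addr_ge0.
- by rewrite divr_ge0// subr_ge0.
- by rewrite divr_ge0// mulr_ge0// subr_ge0.
- by rewrite divr_ge0// ?sqr_ge0// -[W]expr1.
Qed.

Section Energy.
Context {R : realType} {n : nat}.
Notation V := 'rV[R]_n.
Variables (A : set V) (f F : R -> R) (u : V -> R).
Hypotheses (oA : open A) (f_C1 : C1_real f) (F_prim : primitive F f) (u3 : Ck 3 A u).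
Implicit Types (x y v w : V).

Let u2 : Ck 2 A u := CkW u3.
Let u1 : Ck 1 A u := CkW u2.

(** The [P]-function of the equation. It is constant along one-dimensional
    solutions. *)
Definition energy y : R := F (u y) + 1 - (area u y)^-1.

Definition denergy v y : R :=
  f (u y) * dot v (grad u y) + bil (hess u y) v (grad u y) / area u y ^+ 3.

Definition third x : 'M[R]_n := \sum_(k < n) grad u x 0 k *: hess (partial k u) x.

Definition energy_hess x : 'M[R]_n :=
  let p := grad u x in let H := hess u x in let W := area u x in
  derive1 f (u x) *: (p^T *m p) + f (u x) *: H
  + (W ^+ 3)^-1 *: (H *m H^T + third x) - (3 / W ^+ 5) *: ((p *m H)^T *m (p *m H)).

Lemma is_derive_comp_u (phi dphi : R -> R) x v :
  A x -> is_derive (u x) 1 phi (dphi (u x)) ->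
  is_derive x v (fun y => phi (u y)) (dphi (u x) * dot v (grad u x)).
Proof.
move=> Ax dphiP.
exact: (@is_derive_comp R V u x v phi _ _ dphiP (C1_is_derive v oA u1 Ax)).
Qed.

Lemma is_derive_energy x v : A x -> is_derive x v energy (denergy v x).
Proof.
move=> Ax.
have dF := @is_derive_comp_u F f x v Ax (F_prim (u x)).
have dW := is_derive_inv (area_neq0 u x) (is_derive_area v oA u2 Ax).
have := is_derive_sub (is_derive_add dF (is_derive_const x v 1)) dW.
congr is_derive; rewrite /denergy; field; exact: area_neq0.
Qed.

Lemma is_derive_f x v : A x ->
  is_derive x v (fun y => f (u y)) (derive1 f (u x) * dot v (grad u x)).
Proof.
move=> Ax; apply: (@is_derive_comp_u f (derive1 f)) => //.
by apply: DeriveDef; [exact: f_C1.1|rewrite derive1E].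
Qed.

Lemma is_derive_bil_hess_grad x v : A x ->
  is_derive x v (fun y => bil (hess u y) v (grad u y))
    (quad (hess u x *m (hess u x)^T + third x) v).
Proof.
move=> Ax.
rewrite (_ : (fun y => _) =
    (fun y => \sum_(k < n) dot v (grad (partial k u) y) * partial k u y)); last first.
  apply/funext => y; rewrite /bil dotC; apply: eq_bigr => k _.
  by rewrite grad_partial_hess [grad u y 0 k]mxE.
have -> : quad (hess u x *m (hess u x)^T + third x) v =
    \sum_(k < n) (quad (hess (partial k u) x) v * partial k u x +
      dot v (grad (partial k u) x) * dot v (grad (partial k u) x)).
  rewrite bilD quad_mulmx_tr addrC big_split/=; congr (_ + _); last first.
    by apply: eq_bigr => k _; rewrite grad_partial_hess.
  rewrite /third; elim/big_ind2: _ => [|M a M' b <- <-|k _].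
  - by rewrite -(scale0r 0) bilZ mul0r.
  - by rewrite bilD.
  - by rewrite bilZ mxE mulrC.
apply: is_derive_bigsum => k.
have d2 := is_derive_dot_grad v v oA (Ck_partial k u3) Ax.

have d1' := C1_is_derive v oA (Ck_partial k u2) Ax.
exact: is_derive_mul d2 d1'.
Qed.

Lemma is_derive_denergy x v : A x ->
  is_derive x v (denergy v) (quad (energy_hess x) v).
Proof.
move=> Ax.
have d1 := is_derive_mul (is_derive_f v Ax) (is_derive_dot_grad v v oA u2 Ax).
have W3 : area u x ^+ 3 != 0 by rewrite expf_neq0 ?area_neq0.
have d2 := @is_derive_inv R V (fun y => area u y ^+ 3) x v _ W3 (is_derive_cube (is_derive_area v oA u2 Ax)).
have := is_derive_add d1 (is_derive_mul (is_derive_bil_hess_grad v Ax) d2).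
congr is_derive; rewrite /energy_hess.
rewrite !(bilD, bilN, bilZ) !bil_outer.
rewrite -[dot v (grad u x *m hess u x)]/(bil (hess u x) (grad u x) v).
have -> : bil (hess u x) (grad u x) v = bil (hess u x) v (grad u x).
  by rewrite /bil -{1}(hess_sym oA u2 Ax) dot_mulmx_tr dotC.
have Wn := area_neq0 u x.
by field.
Qed.

Hypothesis u_eq : forall x, A x -> mean_curvature_op u x + f (u x) = 0.

Definition cleared_eq y : R :=
  area u y ^+ 2 * \tr (hess u y) - quad (hess u y) (grad u y) + f (u y) * area u y ^+ 3.

Lemma cleared_eq0 x : A x -> cleared_eq x = 0.
Proof.
move=> Ax.
have mE := mean_curvatureE oA u2 Ax.
have E := u_eq Ax.
rewrite mE in E.
have Wn := area_neq0 u x.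
have -> : cleared_eq x = area u x ^+ 3 *
  (\tr (hess u x) / area u x - quad (hess u x) (grad u x) / area u x ^+ 3 + f (u x)).
  by rewrite /cleared_eq; field.
by rewrite E mulr0.
Qed.

Lemma third_entry x i j : A x ->
  third x i j = dot (grad u x) (grad (partial i (partial j u)) x).
Proof.
move=> Ax.
have swap k : partial k (partial i (partial j u)) x = partial i (partial j (partial k u)) x.
  rewrite (Schwarz k i oA (Ck_partial j u3) Ax).
  have E : \forall y \near x, partial k (partial j u) y = partial j (partial k u) y.
    apply: filterS (open_nbhs_nbhs (conj oA Ax)) => y Ay.
    exact: Schwarz oA u2 Ay.
  exact: near_eq_derive E.
rewrite /third summxE /dot; apply: eq_bigr => k _.
have -> : grad (partial i (partial j u)) x 0 k = partial i (partial j (partial k u)) x.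
  by rewrite mxE; exact: swap.
by rewrite mxE /hess [X in _ * X]mxE.
Qed.

Lemma is_derive_quad_hess x v : A x ->
  is_derive x v (fun y => quad (hess u y) (grad u y))
    (2 * dot (v *m hess u x) (grad u x *m hess u x) +
     \sum_(i < n) \sum_(j < n) dot v (grad (partial i (partial j u)) x)
        * grad u x 0 i * grad u x 0 j).
Proof.
move=> Ax.
rewrite (_ : (fun y => _) = (fun y => \sum_(i < n) \sum_(j < n)
   partial i (partial j u) y * partial i u y * partial j u y)); last first.
  apply/funext => y; rewrite /bil /dot exchange_big /=; apply: eq_bigr => j _.
  rewrite !mxE mulr_sumr; apply: eq_bigr => i _; rewrite !mxE; ring.
have -> : dot (v *m hess u x) (grad u x *m hess u x) =
    \sum_(i < n) \sum_(j < n) partial i (partial j u) x * dot v (grad (partial j u) x)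
       * partial i u x.
  rewrite {1}/dot exchange_big /=; apply: eq_bigr => j _.
  rewrite -grad_partial_hess mxE mulr_sumr; apply: eq_bigr => i _.
  by rewrite !mxE; ring.
have E2 : \sum_(i < n) \sum_(j < n) partial i (partial j u) x * dot v (grad (partial j u) x)
       * partial i u x = 
   \sum_(i < n) \sum_(j < n) partial i (partial j u) x * dot v (grad (partial i u) x)
       * partial j u x.
  rewrite exchange_big; apply: eq_bigr => i _; apply: eq_bigr => j _.
  by rewrite (Schwarz _ _ oA u2 Ax).
rewrite mulr_natl mulr2n {1}E2 -!big_split/=; apply: is_derive_bigsum => i.
rewrite -!big_split/=; apply: is_derive_bigsum => j.
have di := C1_is_derive v oA (Ck_partial i u2) Ax.
have dj := C1_is_derive v oA (Ck_partial j u2) Ax.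
have dij := C1_is_derive v oA (Ck_partial i (Ck_partial j u3)) Ax.
apply: is_derive_eq (is_derive_mul (is_derive_mul dij di) dj) _.
have -> : grad u x 0 i = partial i u x by rewrite mxE.
have -> : grad u x 0 j = partial j u x by rewrite mxE.
generalize (partial i (partial j u) x) (partial i u x) (partial j u x)
  (dot v (grad (partial i (partial j u)) x)) (dot v (grad (partial i u) x))
  (dot v (grad (partial j u) x)) => *; ring.
Qed.

(** The derivative of the equation along [grad u]; the symmetry of the third
    derivatives identifies it with the third-order term of the Hessian of the
    energy. *)
Lemma derived_eq x : A x ->
  let p := grad u x in let H := hess u x in let W := area u x in
  2 * quad H p * \tr H + W ^+ 2 * \tr (third x)
  - (2 * dot (p *m H) (p *m H) + quad (third x) p)
  + derive1 f (u x) * dot p p * W ^+ 3 + 3 * f (u x) * W * quad H p = 0.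
Proof.
move=> Ax p H W.
have dtr : is_derive x p (fun y => \tr (hess u y)) (\tr (third x)).
  rewrite (_ : (fun y => _) = (fun y => \sum_(i < n) partial i (partial i u) y)); last first.
    by apply/funext => y; apply: eq_bigr => i _; rewrite mxE.
  apply: is_derive_bigsum => i; rewrite (third_entry i i Ax).
  exact: (C1_is_derive _ oA (Ck_partial i (Ck_partial i u3)) Ax).
have dW := is_derive_area p oA u2 Ax.
have d := is_derive_add (is_derive_sub (is_derive_mul (is_derive_mul dW dW) dtr)
  (is_derive_quad_hess p Ax)) (is_derive_mul (is_derive_f p Ax) (is_derive_cube dW)).
have [_ d0] := d.
have E : \forall y \near x, area u y * area u y * \tr (hess u y) -
   quad (hess u y) (grad u y) + f (u y) * area u y ^+ 3 = cst 0 y.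
  by apply: filterS (open_nbhs_nbhs (conj oA Ax)) => y /cleared_eq0.
have := near_eq_derive p E; rewrite d0 derive_cst => <-.
have -> : \sum_(i < n) \sum_(j < n) dot p (grad (partial i (partial j u)) x)
        * grad u x 0 i * grad u x 0 j = quad (third x) p.
  rewrite /bil /dot [RHS](eq_bigr (fun j => \sum_(i < n)
     dot p (grad (partial i (partial j u)) x) * p 0 i * p 0 j)); last first.
    move=> j _; rewrite !mxE mulr_sumr; apply: eq_bigr => i _.
    by rewrite (third_entry i j Ax) -/p; ring.
  by rewrite exchange_big.
rewrite -/p -/H -/W; have Wn : W != 0 := area_neq0 u x.
by field.
Qed.

(** An elliptic inequality for the energy whose only first order term is the
    derivative along [grad u], with a coefficient independent of the second
    derivatives of [u]. *)
Lemma sum_energy_hess_ge x : A x -> 0 < dot (grad u x) (grad u x) ->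
  - (f (u x) * (dot (grad u x) (grad u x) + 2) /
     (dot (grad u x) (grad u x) * area u x)) * denergy (grad u x) x <=
  \sum_(k < n) quad (energy_hess x) (mc_frame (grad u x) k).
Proof.
move=> Ax N0; rewrite sum_quad_mc_frame -area_sqr.
set p := grad u x in N0 *; set N := dot p p in N0 *.
have W0 := area_gt0 u x; have W2 := area_sqr u x.
have Et := cleared_eq0 Ax; have := derived_eq Ax; rewrite /cleared_eq /= in Et *.
have CZ := frobenius_ge (hess_sym oA u2 Ax) N0.
have := CauchySchwarz p (p *m hess u x); rewrite [X in _ <= X]mulrC => CY ET.
have := energy_trace_scalar N0 W0 W2 Et ET CZ CY.
rewrite /denergy -/p -/N /energy_hess -/p.
rewrite !(bilD, bilN, bilZ) !bil_outer quad_mulmx_tr.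
rewrite !mxtraceD mxtraceN !mxtraceZ mxtraceD !trace_outer trace_mulmx_tr -/N.
rewrite -/(quad (hess u x) p).
move=> h; apply: le_trans h _; rewrite le_eqVlt; apply/orP; left; apply/eqP.
have Wn := area_neq0 u x.
by field.
Qed.

End Energy.

Section Coordinates.
Context {R : realType} {n : nat}.
Notation V := 'rV[R]_n.
Implicit Types (x v w : V).

Lemma is_derive_coord x v i : is_derive x v (fun y : V => y 0 i) (v 0 i).
Proof.
apply/is_derive_line0P; have := is_derive_lin 0 (x 0 i) (v 0 i).
by congr is_derive; apply/funext => s; rewrite !mxE.
Qed.

Lemma is_derive_dotr x v w : is_derive x v (fun y : V => dot w y) (dot w v).
Proof.
rewrite /dot; apply: is_derive_bigsum => i.
have := is_derive_mul (is_derive_const x v (w 0 i)) (is_derive_coord x v i).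
by rewrite mul0r add0r.
Qed.

Lemma is_derive_dotxx x v : is_derive x v (fun y : V => dot y y) (2 * dot v x).
Proof.
rewrite /dot mulr_sumr; apply: is_derive_bigsum => i.
have := is_derive_mul (is_derive_coord x v i) (is_derive_coord x v i).
by congr is_derive; ring.
Qed.

End Coordinates.

Lemma is_derive_expR_scaled (R : realType) (l s : R) :
  is_derive s 1 (fun t : R => expR (l * t)) (l * expR (l * s)).
Proof.
have dl : is_derive s 1 (fun t : R => l * t) l.
  have := is_derive_lin s 0 l; congr is_derive.
  by apply/funext => t; rewrite add0r mulrC.
have := @is_derive_comp R R (fun t : R => l * t) s 1 expR _ _ (is_derive_expR (l * s)) dl.
by rewrite mulrC.
Qed.

Section BarrierTest.
Context {R : realType} {n : nat}.
Notation V := 'rV[R]_n.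
Variables (A : set V) (f F : R -> R) (u : V -> R).
Hypotheses (oA : open A) (f_C1 : C1_real f) (F_prim : primitive F f) (u3 : Ck 3 A u).
Hypothesis u_eq : forall x, A x -> mean_curvature_op u x + f (u x) = 0.
Implicit Types (x y v w : V).

Let u2 : Ck 2 A u := CkW u3.
Let u1 : Ck 1 A u := CkW u2.

(** The two conditions at an interior maximum: the first order one gives the
    derivative of the energy along [grad u], which [sum_energy_hess_ge] turns
    into a lower bound for the trace in the second order one. *)
Lemma energy_barrier_test (eta lam eps : R) x : A x ->
  (\forall y \near x,
    energy F u y + eta * expR (lam * u y) - eps * dot y y <=
    energy F u x + eta * expR (lam * u x) - eps * dot x x) ->
  0 < dot (grad u x) (grad u x) ->
  let p := grad u x in let N := dot p p in let W := area u x in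
  eta * lam * expR (lam * u x) * (lam * N / W ^+ 2 + f (u x) / W) <=
  2 * eps * (f (u x) * (N + 2) / (N * W) * dot p x + n%:R - N / W ^+ 2) :> R.
Proof.
move=> Ax xmax N0.
have W0 := area_gt0 u x; have W2 := area_sqr u x.
pose h y := expR (lam * u y).
pose dQ v y := denergy f u v y + eta * (lam * h y * dot v (grad u y)) - eps * (2 * dot v y).
pose M : 'M[R]_n := energy_hess f u x
  + (eta * lam * h x) *: (lam *: ((grad u x)^T *m grad u x) + hess u x)
  - (2 * eps) *: 1%:M.
have test v : dQ v x = 0 /\ quad M v <= 0.
  have dh y : A y -> is_derive y v h (lam * h y * dot v (grad u y)).
    move=> Ay.
    exact: (is_derive_comp_u (phi := fun s => expR (lam * s))
      (dphi := fun s => lam * expR (lam * s)) oA u3 v Ay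
      (is_derive_expR_scaled lam (u y))).
  have dQP : \forall y \near x, is_derive y v
      (fun y => energy F u y + eta * expR (lam * u y) - eps * dot y y) (dQ v y).
    have := open_nbhs_nbhs (conj oA Ax); apply: filterS => y Ay.
    have d1 := is_derive_mul (is_derive_const y v eta) (dh y Ay).
    have d2 := is_derive_mul (is_derive_const y v eps) (is_derive_dotxx y v).
    have := is_derive_sub (is_derive_add (is_derive_energy oA F_prim u3 v Ay) d1) d2.
    by congr is_derive; rewrite /dQ; ring.
  apply: (line_second_derivative_at_max xmax dQP).
  have d1 := is_derive_mul (is_derive_mul (is_derive_const x v lam) (dh x Ax))
    (is_derive_dot_grad v v oA u2 Ax).
  have d2 := is_derive_mul (is_derive_const x v 2) (is_derive_dotr x v v).
  have := is_derive_sub (is_derive_add (is_derive_denergy oA f_C1 u3 v Ax)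
    (is_derive_mul (is_derive_const x v eta) d1))
    (is_derive_mul (is_derive_const x v eps) d2).
  congr is_derive; rewrite /M !(bilD, bilN, bilZ) bil_outer quad_1; ring.
have Et := cleared_eq0 oA u3 u_eq Ax; rewrite /cleared_eq in Et.
have [+ _] := test (grad u x); rewrite /dQ => d0.
have S0 : \sum_(k < n) quad M (mc_frame (grad u x) k) <= 0.
  by apply: sumr_le0 => k _; have [] := test (mc_frame (grad u x) k).
have Sge := sum_energy_hess_ge oA f_C1 u3 u_eq Ax N0.
rewrite sum_quad_mc_frame -area_sqr in S0.
rewrite sum_quad_mc_frame -area_sqr in Sge.
rewrite /M in S0; move: (energy_hess f u x) Sge S0 => EH Sge.
rewrite !(bilD, bilN, bilZ) bil_outer quad_1.
rewrite !(mxtraceD, mxtraceN, mxtraceZ) trace_outer mxtrace1.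
move: Sge d0 Et N0 W0 W2; rewrite -/(h x).
move: (\tr (hess u x)) (quad (hess u x) (grad u x)) (\tr EH)
  (quad EH (grad u x)) (denergy f u (grad u x) x) (area u x) (h x)
  (dot (grad u x) (grad u x)) (dot (grad u x) x) (f (u x)).
move=> t X TM QM g W hx N px fu Sge d0 Et N0 W0 W2 S0.
have Wn : W != 0 by rewrite gt_eqF.
have NE : N = W ^+ 2 - 1 by rewrite W2 addrC addKr.
have Nn : W ^+ 2 - 1 != 0 by rewrite -NE gt_eqF.
have tE : t = (X - fu * W ^+ 3) / W ^+ 2.
  apply: (mulfI (expf_neq0 2 Wn)); rewrite [RHS]mulrC divfK ?expf_neq0//.
  by apply/eqP; rewrite -subr_eq0 -[X in _ == X]Et; apply/eqP; ring.
have gE : g = eps * (2 * px) - eta * (lam * hx * N).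
  by apply/eqP; rewrite -subr_eq0 -[X in _ == X]d0; apply/eqP; ring.
rewrite /= -subr_le0; apply: le_trans (S0).
move: Sge; rewrite -subr_ge0 => Sge; rewrite -subr_ge0.
apply: le_trans Sge _; rewrite le_eqVlt; apply/orP; left; apply/eqP.
by rewrite gE tE NE; field; rewrite Nn Wn.
Qed.

End BarrierTest.

(** * The half-space *)

Section SupNorm.
Context {R : realType} {n : nat}.
Notation V := 'rV[R]_n.
Implicit Types (x y v : V).

Lemma norm_le_coord x (c : R) : 0 <= c -> (forall i, `|x 0 i| <= c) -> `|x| <= c.
Proof.
move=> c0 xc; rewrite [leLHS]/Num.Def.normr /= mx_normrE.
by apply: bigmax_le => // -[i j] _ /=; rewrite ord1.
Qed.

Lemma norm_le_enorm x : `|x| <= enorm x.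
Proof.
apply: norm_le_coord; first exact: sqrtr_ge0.
by move=> i; rewrite -sqrtr_sqr ler_wsqrtr// coord_sqr_le.
Qed.

Lemma within_continuousP (B : set V) (g : V -> R) :
  {within B, continuous g} <->
  forall y, B y -> forall e : R, 0 < e ->
    exists2 r : R, 0 < r & forall x, B x -> `|x - y| < r -> `|g x - g y| < e.
Proof.
split.
  move=> /subspace_continuousP cg y By e e0.
  have /cvgrPdist_lt /(_ _ e0) := cg y By.
  rewrite near_withinE => /nbhs_normP[r r0 rP]; exists r => // x Bx xy.
  by rewrite distrC; exact: rP.
move=> cg; apply/subspace_continuousP => y By; apply/cvgrPdist_lt => e e0.
have [r r0 rP] := cg y By e e0; rewrite near_withinE; apply/nbhs_normP.
by exists r => // x xy Bx; rewrite distrC; exact: rP.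
Qed.

Lemma within_continuous_segment (B : set V) (g : V -> R) x v :
  {within B, continuous g} -> (forall s : R, s \in `[0, 1] -> B (x + s *: v)) ->
  {within `[0, 1], continuous (fun s : R => g (x + s *: v))}.
Proof.
move=> /subspace_continuousP cg Bs; apply/subspace_continuousP => s s01.
apply: cvg_trans (cg _ (Bs s s01)).
have lc : (fun s : R => x + s *: v) @ s --> x + s *: v.
  by apply: cvgD; [exact: cvg_cst|exact: scalel_continuous].
move=> P; rewrite /= !nbhs_simpl /= => wP.
have := lc _ wP; rewrite /nbhs /= !nbhs_simpl /within /=.
by apply: filterS => t tP t01; apply: tP; exact: Bs.
Qed.

End SupNorm.

Section HalfSpace.
Context {R : realType} {n : nat}.
Notation V := 'rV[R]_n.+1.
Notation H := (upper_half_space R n).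
Notation e := (e_last R n).
Implicit Types (x y v : V) (u : V -> R).

Lemma e_last_coord i : e 0 i = (i == ord_max)%:R.
Proof. by rewrite mxE eqxx. Qed.

Lemma dot_e_last x : dot e x = x 0 ord_max.
Proof. exact: dot_basis. Qed.

Lemma dot_e_last_e_last : dot e e = 1.
Proof. by rewrite dot_e_last e_last_coord eqxx. Qed.

Lemma height_up y (t : R) : (y + t *: e) 0 ord_max = y 0 ord_max + t.
Proof. by rewrite !mxE !eqxx mulr1. Qed.

Lemma open_upper : open H.
Proof.
have := @open_comp _ _ (fun x : V => x 0 ord_max) [set t : R | 0 < t].
by apply; [move=> x _; exact: coord_continuous|exact: open_gt].
Qed.

Lemma closed_upper : closed [set x : V | 0 <= x 0 ord_max].
Proof.
have := @closed_comp _ _ (fun x : V => x 0 ord_max) [set t : R | 0 <= t].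
by apply; [move=> x _; exact: coord_continuous|exact: closed_ge].
Qed.

Lemma closure_upperP y : closure H y <-> 0 <= y 0 ord_max.
Proof.
split=> [Hy|y0].
  have : closure [set x : V | 0 <= x 0 ord_max] y.
    by apply: closure_subset Hy => x /ltW.
  by rewrite -(closure_id _).1//; exact: closed_upper.
move=> B /nbhs_normP[r r0 rB].
have d0 : 0 < `|e| + 1 by rewrite ltr_wpDl.
pose t := r / 2 / (`|e| + 1).
have t0 : 0 < t by rewrite !divr_gt0.
exists (y + t *: e); split; first by rewrite /upper_half_space /= height_up ltr_wpDl.
apply: rB; rewrite addrC addKr normrZ gtr0_norm//.
apply: (@le_lt_trans _ _ (t * (`|e| + 1))); first by rewrite ler_wpM2l ?lerDl ?ltW.
by rewrite /t divfK ?gt_eqF// ltr_pdivrMr// ltr_pMr// ltr1n.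
Qed.

End HalfSpace.

(** * Boundary values of the gradient *)

Section Boundary.
Context {R : realType} {n : nat}.
Notation V := 'rV[R]_n.+1.
Notation H := (upper_half_space R n).
Notation e := (e_last R n).
Variables (kappa : R) (u : V -> R).
Hypothesis u1 : C1_up_to_boundary H u.
Hypothesis u_dirichlet : forall x, upper_boundary R n x -> u x = 0.
Hypothesis u_neumann : forall x, upper_boundary R n x ->
  has_normal_derivative u x (exterior_normal R n) kappa.
Implicit Types (x y v : V).

Lemma boundary_closure y : upper_boundary R n y -> closure H y.
Proof. by move=> y0; apply/closure_upperP; rewrite y0. Qed.

Lemma upper_closure y : H y -> closure H y.
Proof. by move=> y0; apply/closure_upperP; exact: ltW. Qed.

Lemma vertical_upper y (t : R) : closure H y -> 0 < t -> H (y + t *: e).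
Proof.
by move=> /closure_upperP y0 t0; rewrite /upper_half_space /= height_up ltr_wpDl.
Qed.

Lemma upper_is_derive x v : H x -> is_derive x v u (dot v (grad u x)).
Proof. by have [u1' _ _] := u1; exact: C1_is_derive open_upper u1'. Qed.

Lemma u_continuous_closure : {within closure H, continuous u}.
Proof. by have [] := u1. Qed.

Lemma boundary_quotient y (eps : R) : upper_boundary R n y -> 0 < eps ->
  exists2 r : R, 0 < r &
    forall t : R, 0 < t < r -> `|u (y + t *: e) / t + kappa| < eps.
Proof.
move=> y0 eps0; have := u_neumann y0; rewrite /has_normal_derivative.
move=> /cvgrPdist_lt /(_ _ eps0); rewrite near_withinE => /nbhs_ballP[r r0 rP].
exists r => // t /andP[t0 tr].
have := rP (- t); rewrite -ball_normE /= sub0r opprK gtr0_norm// oppr_lt0 => /(_ tr t0).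
rewrite (u_dirichlet y0) subr0 /exterior_normal scalerN scaleNr opprK invrN mulNr opprK.
by rewrite addrC [_ / t]mulrC.
Qed.

Lemma vertical_MVT y (t : R) : closure H y -> 0 < t ->
  exists2 s : R, 0 < s < t &
    u (y + t *: e) - u y = t * grad u (y + s *: e) 0 ord_max.
Proof.
move=> yH t0.
have Hs (s : R) : s \in `]0, 1[ -> H (y + s *: (t *: e)).
  rewrite in_itv/= => /andP[s0 _]; rewrite scalerA.
  by apply: vertical_upper => //; rewrite mulr_gt0.
have cu : {within `[0, 1], continuous (fun s : R => u (y + s *: (t *: e)))}.
  apply: within_continuous_segment u_continuous_closure _ => s.
  rewrite in_itv/= => /andP[s0 _]; apply/closure_upperP.
  by rewrite scalerA height_up addr_ge0 ?mulr_ge0 ?(ltW t0)//; apply/closure_upperP.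
have du (s : R) : s \in `]0, 1[ ->
    is_derive (y + s *: (t *: e)) (t *: e) u (t * grad u (y + s *: (t *: e)) 0 ord_max).
  move=> /Hs Hys; have := upper_is_derive (t *: e) Hys.
  by rewrite dotZl dot_e_last.
have [s] := line_MVT cu du.
rewrite in_itv/= => /andP[s0 s1] ->; exists (s * t); last by rewrite scalerA.
by rewrite mulr_gt0//= gtr_pMl.
Qed.

(** The tangential components vanish because [u] does on the boundary; the
    normal one is the prescribed normal derivative. *)
Lemma boundary_gradient : exists G : V -> V,
  [/\ forall i, {within closure H, continuous (fun x => G x 0 i)},
      forall x, H x -> G x = grad u x &
      forall y, upper_boundary R n y -> G y = - kappa *: e].
Proof.
have [_ _ /choice[g gP]] := u1.
exists (fun x => \row_i g i x); split.
- by move=> i; under eq_fun do rewrite mxE; have [] := gP i.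
- by move=> x Hx; apply/rowP => i; rewrite !mxE; have [_ ->] := gP i.
move=> y y0; apply/rowP => i; rewrite !mxE eqxx /=.
have yH := boundary_closure y0.
have [gc gE] := gP i; have gcy := (within_continuousP _ _).1 gc y yH.
have [im|im] := eqVneq i ord_max.
  rewrite mulr1; apply/eqP; rewrite -subr_eq0 opprK -normr_le0; apply/ler_addgt0Pl => eps eps0.
  have eps20 : 0 < eps / 2 by rewrite divr_gt0.
  have [r r0 rP] := gcy _ eps20; have [r' r'0 r'P] := boundary_quotient y0 eps20.
  have d0 : 0 < `|e| + 1 by rewrite ltr_wpDl.
  pose t := Num.min (r / (`|e| + 1)) r' / 2.
  have m0 : 0 < Num.min (r / (`|e| + 1)) r' by rewrite lt_min divr_gt0.
  have t0 : 0 < t by rewrite divr_gt0.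
  have tm : t < Num.min (r / (`|e| + 1)) r' by rewrite ltr_pdivrMr// ltr_pMr// ltr1n.
  have /andP[tr tr'] : (t < r / (`|e| + 1)) && (t < r') by rewrite -lt_min.
  have [s /andP[s0 st] E] := vertical_MVT yH t0.
  have sH : H (y + s *: e) by exact: vertical_upper.
  have := r'P t; rewrite t0 tr' => /(_ isT).
  rewrite -[u (y + _)]subr0 -[in X in _ - X](u_dirichlet y0) E mulrC mulKf ?gt_eqF//.
  have -> : grad u (y + s *: e) 0 ord_max = g i (y + s *: e).
    by rewrite gE// mxE im.
  have gs : `|g i (y + s *: e) - g i y| < eps / 2.
    apply: rP; first exact: upper_closure.
    rewrite addrC addKr normrZ gtr0_norm//.
    apply: (@le_lt_trans _ _ (t * (`|e| + 1))).
      by rewrite ler_pM ?lerDl// ltW.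
    by rewrite -ltr_pdivlMr.
  set a := g i (y + s *: e) in gs * => ka; rewrite addr0.
  have -> : g i y + kappa = (a + kappa) - (a - g i y) by ring.
  by rewrite (le_trans (ler_normB _ _))// [eps]splitr lerD// ltW.
rewrite mulr0; apply/eqP/negPn/negP => gy0; set c := `|g i y|.
have c0 : 0 < c by rewrite normr_gt0.
have c20 : 0 < c / 2 by rewrite divr_gt0.
have [r r0 rP] := gcy _ c20.
pose b : V := basis_vec i.
have bn : b 0 ord_max = 0 by rewrite mxE eqxx eq_sym (negbTE im).
have bh z (k : R) : (z + k *: b) 0 ord_max = z 0 ord_max.
  by rewrite mxE [(k *: b) _ _]mxE bn mulr0 addr0.
have d0 : 0 < `|e| + `|b| + 1 by rewrite ltr_wpDl ?addr_ge0.
have [d dp dr] : exists2 d : R, 0 < d & d * (`|e| + `|b| + 1) < r.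
  exists (r / 2 / (`|e| + `|b| + 1)); first by rewrite !divr_gt0.
  by rewrite divfK ?gt_eqF// ltr_pdivrMr// ltr_pMr// ltr1n.
have eta0 : 0 < d * (c / 2) / 2 by rewrite divr_gt0// mulr_gt0.
(* Both ends of a short horizontal segment at small height carry small values,
   which bounds the slope along the segment. *)
have small z : upper_boundary R n z -> exists2 r' : R, 0 < r' & forall t : R,
    0 < t < r' -> `|u (z + t *: e)| < d * (c / 2) / 2.
  move=> z0; have zH := boundary_closure z0.
  have [r' r'0 r'P] := (within_continuousP _ _).1 u_continuous_closure z zH _ eta0.
  have e1 : 0 < `|e| + 1 by rewrite ltr_wpDl.
  exists (r' / (`|e| + 1)); first by rewrite divr_gt0.
  move=> t /andP[t0 tr].
  have := r'P (z + t *: e); rewrite (u_dirichlet z0) subr0; apply.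
    by apply: upper_closure; exact: vertical_upper.
  rewrite addrC addKr normrZ gtr0_norm//.
  apply: (@le_lt_trans _ _ (t * (`|e| + 1))); first by rewrite ler_wpM2l ?lerDl// ltW.
  by rewrite -ltr_pdivlMr.
have ydb : upper_boundary R n (y + d *: b).
  by rewrite /upper_boundary /= bh; exact: y0.
have [r1 r10 r1P] := small y y0; have [r2 r20 r2P] := small _ ydb.
pose t := Num.min d (Num.min r1 r2) / 2.
have m0 : 0 < Num.min d (Num.min r1 r2) by rewrite !lt_min dp r10 r20.
have t0 : 0 < t by rewrite divr_gt0.
have : t < Num.min d (Num.min r1 r2) by rewrite ltr_pdivrMr// ltr_pMr// ltr1n.
rewrite !lt_min => /and3P[td tr1 tr2].
have u1s := r1P t; have u2s := r2P t.
rewrite t0 tr1 in u1s; rewrite t0 tr2 in u2s.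
have Hs (s : R) : H (y + t *: e + s *: (d *: b)).
  by rewrite scalerA /upper_half_space /= bh; exact: vertical_upper.
have du (s : R) : s \in `[0, 1] -> is_derive (y + t *: e + s *: (d *: b)) (d *: b) u
     (d * g i (y + t *: e + s *: (d *: b))).
  move=> _; have := upper_is_derive (d *: b) (Hs s).
  by rewrite dotZl dot_basis mxE gE.
have [s s01] := line_MVT_derive du; set z := y + t *: e + s *: (d *: b) => E.
have gz : `|g i z - g i y| < c / 2.
  apply: rP; first by apply: upper_closure; exact: Hs.
  apply: norm_segment (subset_itv_oo_cc s01).
  rewrite !normrZ !gtr0_norm//; apply: le_lt_trans dr.
  rewrite !mulrDr mulr1 -[leLHS]addr0; apply: lerD (ltW dp).
  by rewrite lerD2r ler_wpM2r// ltW.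
have u1s' := u1s isT; have := u2s isT; rewrite addrAC => u2s'.
have : `|d * g i z| < d * (c / 2).
  by rewrite -E (le_lt_trans (ler_normB _ _))// [X in _ < X]splitr ltrD.
rewrite normrM gtr0_norm// ltr_pM2l// => gz'.
have : c <= `|g i z| + `|g i z - g i y|.
  by have := ler_normB (g i z) (g i z - g i y); rewrite opprB addrCA subrr addr0.
by apply/negP; rewrite -ltNge [c]splitr ltrD.
Qed.

End Boundary.

(** * Continuity and compactness *)

Section WithinContinuity.
Context {R : realType} {T : topologicalType}.
Variable B : set T.
Implicit Types (f g : T -> R).

Lemma within_comp g (phi : R -> R) : {within B, continuous g} -> continuous phi ->
  {within B, continuous (fun y => phi (g y))}.
Proof. by move=> cg cphi y; apply: continuous_comp; [exact: cg|exact: cphi]. Qed.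

Lemma within_add f g : {within B, continuous f} -> {within B, continuous g} ->
  {within B, continuous (fun y => f y + g y)}.
Proof. by move=> cf cg y; apply: cvgD; [exact: cf|exact: cg]. Qed.

Lemma within_sub f g : {within B, continuous f} -> {within B, continuous g} ->
  {within B, continuous (fun y => f y - g y)}.
Proof. by move=> cf cg y; apply: cvgB; [exact: cf|exact: cg]. Qed.

Lemma within_mul f g : {within B, continuous f} -> {within B, continuous g} ->
  {within B, continuous (fun y => f y * g y)}.
Proof. by move=> cf cg y; apply: cvgM; [exact: cf|exact: cg]. Qed.

Lemma within_cst (c : R) : {within B, continuous (fun=> c)}.
Proof. by move=> y; exact: cvg_cst. Qed.

Lemma within_comp_local g (phi : R -> R) : {within B, continuous g} ->
  (forall y, B y -> {for g y, continuous phi}) ->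
  {within B, continuous (fun y => phi (g y))}.
Proof.
move=> /subspace_continuousP gc phic; apply/subspace_continuousP => y By.
by apply: (cvg_comp _ phi (gc y By)); exact: phic.
Qed.

Lemma within_bigsum n (h : 'I_n -> T -> R) :
  (forall i, {within B, continuous (h i)}) ->
  {within B, continuous (fun y => \sum_(i < n) h i y)}.
Proof.
move=> ch; elim: n h ch => [|n IH] h ch.
  by under eq_fun do rewrite big_ord0; exact: within_cst.
by under eq_fun do rewrite big_ord_recr/=; apply: within_add; [exact: IH|exact: ch].
Qed.

End WithinContinuity.

Lemma continuous_inv_sqrt1p (R : realType) :
  continuous (fun s : R => (Num.sqrt (1 + `|s|))^-1).
Proof.
move=> s; apply: cvgV; first by rewrite gt_eqF// sqrtr_gt0 ltr_wpDr.
apply: (@continuous_comp R R R (fun s => 1 + `|s|)); last exact: sqrt_continuous.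
by apply: cvgD; [exact: cvg_cst|exact: norm_continuous].
Qed.

Lemma derivable_bounded_on (R : realType) (f : R -> R) (C : R) :
  (forall t, derivable f t 1) -> 0 <= C ->
  exists2 K : R, 0 <= K & forall s, 0 <= s <= C -> `|f s| <= K.
Proof.
move=> df C0.
have cf : {within `[0, C], continuous (fun s : R => `|f s|)}.
  apply: within_comp; last exact: norm_continuous.
  by apply: continuous_subspaceT => s; apply/differentiable_continuous/derivable1_diffP.
have [c _ cP] := EVT_max C0 cf.
by exists `|f c| => // s sC; apply: cP; rewrite in_itv.
Qed.

Lemma continuous_dot_sub (R : realType) (n : nat) (c : 'rV[R]_n) :
  continuous (fun y : 'rV[R]_n => dot (y - c) (y - c)).
Proof.
have ci i : continuous (fun y : 'rV[R]_n => (y - c) 0 i).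
  rewrite (_ : (fun _ => _) = (fun y : 'rV[R]_n => y 0 i - c 0 i)); last first.
    by apply/funext => y; rewrite !mxE.
  have c1 : continuous (fun y : 'rV[R]_n => y 0 i) by move=> y; exact: coord_continuous.
  apply/continuous_subspace_setT; move/continuous_subspace_setT: c1 => c1.
  exact: (within_sub c1 (@within_cst _ _ _ (c 0 i))).
apply/continuous_subspace_setT; apply: within_bigsum => i.
by have /continuous_subspace_setT cT := ci i; exact: (within_mul cT cT).
Qed.

Lemma continuous_dot_subl (R : realType) (n : nat) (c b : 'rV[R]_n) :
  continuous (fun y : 'rV[R]_n => dot (y - c) b).
Proof.
rewrite (_ : (fun _ => _) = (fun y => dot b y - dot b c)); last first.
  by apply/funext => y; rewrite dotC dotBr.
have cb : continuous (fun y : 'rV[R]_n => dot b y).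
  apply/continuous_subspace_setT; apply: within_bigsum => i.
  have ci : continuous (fun y : 'rV[R]_n => y 0 i) by move=> y; exact: coord_continuous.
  move/continuous_subspace_setT: ci => ci.
  exact: (within_mul (@within_cst _ _ _ (b 0 i)) ci).
apply/continuous_subspace_setT; move/continuous_subspace_setT: cb => cb.
exact: (within_sub cb (@within_cst _ _ _ (dot b c))).
Qed.

Lemma compact_dot_le (R : realType) (n : nat) (c : 'rV[R]_n) (M : R) :
  compact [set y : 'rV[R]_n | dot (y - c) (y - c) <= M].
Proof.
apply: bounded_closed_compact.
  exists (Num.sqrt M + `|c|); split; first exact: num_real.
  move=> k Mk y yM; apply: (le_trans _ (ltW Mk)).
  rewrite -[y](subrK c); apply: (le_trans (ler_normD _ _)); rewrite lerD2r.
  by apply: (le_trans (norm_le_enorm _)); exact: ler_wsqrtr.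
have := @closed_comp _ _ (fun y : 'rV[R]_n => dot (y - c) (y - c)) [set t : R | t <= M].
by apply; [move=> y _; exact: continuous_dot_sub|exact: closed_le].
Qed.

Lemma area_ge1 (R : realType) (n : nat) (u : 'rV[R]_n -> R) x : 1 <= area u x.
Proof.
rewrite -[leLHS]sqrtr1; apply: ler_wsqrtr.
by rewrite lerDl dotxx_ge0.
Qed.

(** The second derivative test at an interior maximum, with the exponent [lam]
    large enough for the exponential to beat the zero-order terms. *)
Lemma barrier_scalar (R : realFieldType) (K B eta lam eps N W fu px d h m : R) : 0 < N -> 1 <= W ->
  W ^+ 2 = 1 + N -> d <= N -> 0 < d -> N <= B -> `|fu| <= K -> 0 <= K -> 0 < eta ->
  lam = (1 + B) * (K + 1) / d -> 1 <= h -> 0 < eps ->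
  eta * lam * h * (lam * N / W ^+ 2 + fu / W) <=
    2 * eps * (fu * (N + 2) / (N * W) * px + m - N / W ^+ 2) ->
  eta * lam <= 2 * (K * (B + 2) / d * (eps * `|px|) + eps * m).
Proof.
move=> N0 W1 W2 dN d0 NB fK K0 eta0 lamE h1 eps0 test.
have W0 : 0 < W := lt_le_trans ltr01 W1.
have B0 : 0 < B := lt_le_trans N0 NB.
have B1 : 0 < 1 + B by rewrite addr_gt0.
have lam0 : 0 < lam by rewrite lamE !mulr_gt0 ?invr_gt0// ltr_wpDl.
have fW : `|fu / W| <= K.
  rewrite normrM normfV (gtr0_norm W0) ler_pdivrMr//; apply: (le_trans fK).
  by rewrite ler_peMr.
have ge1 : 1 <= lam * N / W ^+ 2 + fu / W.
  have : K + 1 <= lam * N / W ^+ 2.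
    have -> : lam * N / W ^+ 2 = (K + 1) * ((N / d) * ((1 + B) / (1 + N))).
      by rewrite lamE W2; field; rewrite !gt_eqF// addr_gt0.
    rewrite ler_peMr ?addr_ge0// mulr_ege1//; first by rewrite ler_pdivlMr// mul1r.
    by rewrite ler_pdivlMr ?addr_gt0// mul1r lerD2l.
  by move: fW; rewrite ler_norml => /andP[]; lra.
have lhs : eta * lam <= eta * lam * h * (lam * N / W ^+ 2 + fu / W).
  have el0 : 0 <= eta * lam by rewrite mulr_ge0 ?ltW.
  by rewrite -mulrA; apply: ler_peMr => //; rewrite mulr_ege1.
have cK : `|fu * (N + 2) / (N * W)| <= K * (B + 2) / d.
  have -> : fu * (N + 2) / (N * W) = fu / W * ((N + 2) / N).
    by field; rewrite !gt_eqF.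
  rewrite normrM -mulrA; apply: ler_pM => //.
  have N2 : 0 < N + 2 by rewrite addr_gt0.
  rewrite ger0_norm; last by rewrite divr_ge0// ltW.
  by apply: ler_pM; rewrite ?invr_ge0 ?lerD2r ?(ltW N0) ?(ltW N2)// lef_pV2.
apply: (le_trans lhs); apply: (le_trans test).
rewrite -mulrA ler_pM2l// mulrBr mulrDr.
have : eps * (fu * (N + 2) / (N * W) * px) <= K * (B + 2) / d * (eps * `|px|).
  rewrite mulrCA; apply: (le_trans (ler_norm _)); rewrite normrM [`|eps * px|]normrM.
  by rewrite (gtr0_norm eps0) ler_wpM2r// mulr_ge0// ltW.
have : 0 <= eps * (N / W ^+ 2) by rewrite mulr_ge0 ?divr_ge0 ?exprn_ge0// ltW.
set X := eps * (N / _); set Y := eps * (_ * px); set Z := _ * (eps * _); lra.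
Qed.

(** * The gradient bound *)

Section Modica.
Context {R : realType} {n : nat}.
Notation V := 'rV[R]_n.+1.
Notation H := (upper_half_space R n).
Variables (f F : R -> R) (kappa C : R) (u : V -> R).
Hypotheses (f_C1 : C1_real f) (F_prim : primitive F f) (F_le0 : forall t, F t <= 0).
Hypothesis F0_ge : (Num.sqrt (1 + kappa ^+ 2))^-1 - 1 <= F 0.
Hypotheses (u3 : Ck 3 H u) (u1 : C1_up_to_boundary H u).
Hypothesis u_eq : forall x, H x -> mean_curvature_op u x + f (u x) = 0.
Hypothesis u_gt0 : forall x, H x -> 0 < u x.
Hypothesis u_dirichlet : forall x, upper_boundary R n x -> u x = 0.
Hypothesis u_neumann : forall x, upper_boundary R n x ->
  has_normal_derivative u x (exterior_normal R n) kappa.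
Hypothesis u_le : forall x, H x -> u x <= C.
Hypothesis grad_le : forall x, H x -> enorm (grad u x) <= C.
Implicit Types (x y v : V).

Definition boundary_energy : R := F 0 + 1 - (Num.sqrt (1 + kappa ^+ 2))^-1.

Lemma boundary_energy_ge0 : 0 <= boundary_energy.
Proof. by rewrite /boundary_energy -addrA -[_ - _]opprB subr_ge0. Qed.

Lemma F_continuous : continuous F.
Proof. by move=> t; have := F_prim t; exact: is_derive_continuous. Qed.

Lemma grad_sqr_le x : H x -> dot (grad u x) (grad u x) <= C ^+ 2.
Proof.
move=> Hx; rewrite -enorm_sqr lerXn2r ?nnegrE ?sqrtr_ge0 ?grad_le//.
by rewrite (le_trans _ (u_le Hx))// ltW// u_gt0.
Qed.

Lemma energy_le1 x : H x -> energy F u x <= 1.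
Proof.
move=> Hx; have W0 := ltW (area_gt0 u x).
rewrite /energy -[leRHS]subr0 lerB ?invr_ge0//.
by rewrite -[leRHS]add0r lerD.
Qed.

Lemma grad_sqr_ge_energy x : H x -> energy F u x <= dot (grad u x) (grad u x).
Proof.
move=> Hx; have W1 := area_ge1 u x; have W2 := area_sqr u x; have W0 := area_gt0 u x.
have -> : dot (grad u x) (grad u x) = area u x ^+ 2 - 1 by rewrite W2 addrC addKr.
rewrite /energy; apply: (@le_trans _ _ (1 - (area u x)^-1)).
  by rewrite lerD2r -[leRHS]add0r lerD.
have -> : 1 - (area u x)^-1 = (area u x - 1) / area u x.
  by rewrite mulrBl mulfV ?gt_eqF// mul1r.
rewrite ler_pdivrMr//.
have : 0 <= (area u x - 1) * ((area u x + 1) * area u x - 1).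
  rewrite mulr_ge0 ?subr_ge0//; apply: (le_trans W1).
  by rewrite ler_peMl// ?lerDr// ltW.
move=> h; rewrite -subr_ge0; apply: le_trans h _.
by rewrite le_eqVlt; apply/orP; left; apply/eqP; ring.
Qed.

(** Maximizing [P + eta exp(lam u) - eps |x|^2] replaces the compactness argument
    at infinity: the exponential of the bounded function [u] is a strict
    subsolution where [P > 0], since there [grad u] is bounded away from zero. *)
Lemma barrier_maximum (eta lam eps : R) x1 :
  H x1 -> 0 <= lam -> 0 < eps ->
  let Q y := energy F u y + eta * expR (lam * u y) - eps * dot y y in
  0 <= eta -> eta * expR (lam * C) + boundary_energy < Q x1 ->
  exists x0, [/\ H x0, Q x1 <= Q x0 & forall y, H y -> Q y <= Q x0].
Proof.
move=> Hx1 lam0 eps0 Q eta0 Qx1.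
have C0 : 0 <= C by rewrite (le_trans _ (u_le Hx1))// ltW// u_gt0.
have [G [Gc GE Gb]] := boundary_gradient u1 u_dirichlet u_neumann.
pose Q' y := F (u y) + 1 - (Num.sqrt (1 + `|dot (G y) (G y)|))^-1
  + eta * expR (lam * u y) - eps * dot y y.
have QE y : H y -> Q' y = Q y.
  by move=> Hy; rewrite /Q' /Q /energy /area GE// ger0_norm ?dotxx_ge0.
have uC y : closure H y -> u y <= C.
  move=> /closure_upperP; rewrite le_eqVlt => /orP[/eqP y0|]; last exact: u_le.
  by rewrite (u_dirichlet (esym y0)).
have Eb y : closure H y -> eta * expR (lam * u y) <= eta * expR (lam * C).
  by move=> /uC uy; rewrite ler_wpM2l// ler_expR ler_wpM2l.
pose M := (1 + eta * expR (lam * C)) / eps.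
have out y : closure H y -> M < dot y y -> Q' y < 0.
  move=> Hy; rewrite ltr_pdivrMr// [_ * eps]mulrC => My; rewrite /Q' subr_lt0.
  apply: le_lt_trans My; apply: lerD (Eb y Hy).
  rewrite -[leRHS]subr0 lerB ?invr_ge0 ?sqrtr_ge0//.
  by rewrite -[leRHS]add0r lerD.
have Qx1p : 0 < Q x1.
  apply: le_lt_trans Qx1; rewrite addr_ge0 ?boundary_energy_ge0// mulr_ge0// ltW// expR_gt0.
pose B := closure H `&` [set y | dot y y <= M].
have cB : compact B.
  rewrite /B setIC; apply: compact_closedI; last exact: closed_closure.
  rewrite (_ : [set y | _] = [set y : V | dot (y - 0) (y - 0) <= M]).
    exact: compact_dot_le.
  by apply/seteqP; split=> y /=; rewrite subr0.
have Bx1 : B x1.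
  split; first exact: upper_closure.
  rewrite /= leNgt; apply/negP => /(out _ (upper_closure Hx1)).
  by rewrite QE// ltNge ltW.
have Q'c : {within closure H, continuous Q'}.
  have uc := u_continuous_closure u1.
  apply: within_sub; [apply: within_add; [apply: within_sub|]|].
  - apply: within_add; last exact: within_cst.
    by apply: within_comp uc _; exact: F_continuous.
  - apply: (within_comp _ (@continuous_inv_sqrt1p R)).
    by apply: within_bigsum => i; apply: within_mul; exact: Gc.
  - apply: within_mul; first exact: within_cst.
    apply: (within_comp (phi := fun s => expR (lam * s)) uc) => s.
    by have := is_derive_expR_scaled lam s; exact: is_derive_continuous.
  - apply: within_mul; first exact: within_cst.
    apply: within_bigsum => i.
    have ci : {within closure H, continuous (fun y : V => y 0 i)}.
      by apply: continuous_subspaceT => y; exact: coord_continuous.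
    exact: (within_mul ci ci).
have Q'cB : {within B, continuous Q'}.
  by apply: continuous_subspaceW Q'c => y [].
have [x0 /set_mem[x0H x0M] x0max] := compact_EVT_max (ex_intro _ x1 Bx1) cB Q'cB.
have Q01 : Q x1 <= Q' x0 by rewrite -QE//; apply: x0max; exact/mem_set.
have Hx0 : H x0.
  move: (x0H) => /closure_upperP; rewrite le_eqVlt => /orP[/eqP/esym x0b|//].
  have := lt_le_trans Qx1 Q01; rewrite ltNge => /negP; case.
  rewrite /Q' (u_dirichlet x0b) Gb// dotZl dotZr dot_e_last_e_last mulr1.
  have -> : `|- kappa * - kappa| = kappa ^+ 2 by rewrite mulrNN -expr2 ger0_norm ?sqr_ge0.
  rewrite -/boundary_energy [leRHS]addrC -[leRHS]subr0; apply: lerB.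
    by rewrite lerD2l; have := Eb x0 x0H; rewrite (u_dirichlet x0b).
  by rewrite mulr_ge0 ?dotxx_ge0 ?(ltW eps0).
exists x0; split=> //; first by rewrite -(QE x0).
move=> y Hy; rewrite -!QE//; have [yM|My] := leP (dot y y) M.
  by apply: x0max; apply/mem_set; split=> //; exact: upper_closure.
by apply: ltW; apply: lt_trans (lt_le_trans Qx1p Q01); apply: out => //; exact: upper_closure.
Qed.

(** At an interior maximum of the barrier the energy exceeds its boundary value
    by at least [d], hence the squared norm of the gradient is at least [d], and
    the test of [energy_barrier_test] applies with constants independent of [eps]. *)
Theorem energy_le_boundary x : H x -> energy F u x <= boundary_energy.
Proof.
move=> Hx; rewrite leNgt; apply/negP => Px.
set c0 := boundary_energy in Px *; have c00 : 0 <= c0 := boundary_energy_ge0.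
have C0 : 0 <= C by rewrite (le_trans _ (u_le Hx))// ltW// u_gt0.
pose d := (energy F u x - c0) / 3.
have d0 : 0 < d by rewrite divr_gt0// subr_gt0.
have [K K0 fK] := derivable_bounded_on f_C1.1 C0.
pose B := C ^+ 2 + 1.
have B0 : 0 < B by rewrite ltr_wpDl// sqr_ge0.
pose lam := (1 + B) * (K + 1) / d.
have K1 : 0 < K + 1 by rewrite ltr_wpDl.
have B1 : 0 < 1 + B by rewrite addr_gt0.
have lam0 : 0 < lam by rewrite divr_gt0// mulr_gt0.
pose eta := d / expR (lam * C).
have eta0 : 0 < eta by rewrite divr_gt0// expR_gt0.
pose L := 2 * (K * (B + 2) / d * C + n.+1%:R).
have L0 : 0 <= L.
  by rewrite mulr_ge0// addr_ge0// mulr_ge0// divr_ge0 ?(ltW d0)// mulr_ge0// addr_ge0// ltW.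
pose D := dot x x + 1.
have D0 : 0 < D by rewrite ltr_wpDl// dotxx_ge0.
have L1 : 0 < L + 1 by rewrite ltr_wpDl.
have [w [w0 w1 wD wL]] : exists w : R, [/\ 0 < w, w <= 1, w * D <= d & w * (L + 1) <= eta * lam].
  exists (Num.min 1 (Num.min (d / D) (eta * lam / (L + 1)))).
  set w := Num.min _ _.
  have : w <= Num.min 1 (Num.min (d / D) (eta * lam / (L + 1))) by [].
  rewrite !le_min => /and3P[? ? ?]; split=> //; rewrite -?ler_pdivlMr//.
  by rewrite !lt_min ltr01 (divr_gt0 d0 D0) (divr_gt0 (mulr_gt0 eta0 lam0) L1).
(* With [eps = w^2] the first order error [eps |x0|] is at most [w], since
   [eps |x0|^2 <= 1] by the bounds on the energy. *)
pose eps := w ^+ 2; have eps0 : 0 < eps by rewrite exprn_gt0.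
have epsw : eps <= w by rewrite /eps expr2 ler_piMl// ltW.
pose Q y := energy F u y + eta * expR (lam * u y) - eps * dot y y.
have etaC : eta * expR (lam * C) = d by rewrite divfK// gt_eqF// expR_gt0.
have Qx : d + c0 + d <= Q x.
  have PE : energy F u x = c0 + 3 * d by rewrite /d; field.
  have : eps * dot x x <= d.
    apply: le_trans wD; apply: ler_pM => //; first exact: ltW.
      exact: dotxx_ge0.
    by rewrite lerDl.
  have : 0 <= eta * expR (lam * u x) by rewrite mulr_ge0 ?expR_ge0// ltW.
  by rewrite /Q PE; lra.
have Qx' : eta * expR (lam * C) + boundary_energy < Q x.
  by rewrite etaC; apply: lt_le_trans Qx; rewrite ltrDl.
have [x0 [H0 Q01 Q0max]] := barrier_maximum Hx (ltW lam0) eps0 (ltW eta0) Qx'.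
rewrite -/(Q x) -/(Q x0) in Q01.
have ux0 : 0 <= u x0 <= C by rewrite u_le// ltW// u_gt0.
have h0 : eta * expR (lam * u x0) <= d.
  rewrite -etaC ler_pM2l// ler_expR ler_pM2l//; exact: u_le.
have E0 : d + c0 + eps * dot x0 x0 <= energy F u x0.
  by move: (le_trans Qx Q01); rewrite /Q; lra.
have ex0 : 0 <= eps * dot x0 x0 by rewrite mulr_ge0 ?dotxx_ge0// ltW.
have Nd : d <= dot (grad u x0) (grad u x0).
  by apply: le_trans (grad_sqr_ge_energy H0); lra.
have N0 := lt_le_trans d0 Nd.
have ex1 : eps * dot x0 x0 <= 1 by have := energy_le1 H0; lra.
have x0max : \forall y \near x0, energy F u y + eta * expR (lam * u y) - eps * dot y y <=
    energy F u x0 + eta * expR (lam * u x0) - eps * dot x0 x0.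
  by have := open_nbhs_nbhs (conj open_upper H0); apply: filterS => y; exact: Q0max.
have test := energy_barrier_test open_upper f_C1 F_prim u3 u_eq H0 x0max N0.
have h1 : 1 <= expR (lam * u x0).
  rewrite -expR0 ler_expR mulr_ge0 ?(ltW lam0)//; by case/andP: ux0.
have NB : dot (grad u x0) (grad u x0) <= B.
  by apply: (le_trans (grad_sqr_le H0)); rewrite lerDl.
have main := barrier_scalar N0 (area_ge1 u x0) (area_sqr u x0) Nd d0 NB
  (fK _ ux0) K0 eta0 (erefl lam) h1 eps0 test.
have px : eps * `|dot (grad u x0) x0| <= w * C.
  have Cw : 0 <= w * C by rewrite mulr_ge0// ltW.
  have px0 : 0 <= eps * `|dot (grad u x0) x0| by rewrite mulr_ge0// ltW.
  rewrite -ler_sqr ?nnegrE// exprMn real_normK ?num_real//.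
  apply: (@le_trans _ _ (eps * C ^+ 2 * (eps * dot x0 x0))); last first.
    by rewrite [leRHS]exprMn -/eps ler_piMr// mulr_ge0 ?sqr_ge0// ltW.
  have -> : eps * C ^+ 2 * (eps * dot x0 x0) = eps ^+ 2 * (C ^+ 2 * dot x0 x0) by ring.
  rewrite ler_pM2l ?exprn_gt0//; apply: (le_trans (CauchySchwarz _ _)).
  by rewrite ler_wpM2r ?dotxx_ge0// grad_sqr_le.
have : eta * lam <= w * L.
  apply: (le_trans main); rewrite /L [leRHS]mulrCA ler_pM2l// [w * (_ + _)]mulrDr; apply: lerD.
    have k0 : 0 <= K * (B + 2) / d.
      by rewrite divr_ge0 ?(ltW d0)// mulr_ge0// addr_ge0// ltW.
    by rewrite [leRHS]mulrCA ler_wpM2l.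
  by rewrite ler_wpM2r.
by move: wL; rewrite mulrDr mulr1; lra.
Qed.

End Modica.

(** * The boundary energy is not attained by [F] *)

Section VerticalLines.
Context {R : realType} {n : nat}.
Notation V := 'rV[R]_n.+1.
Notation H := (upper_half_space R n).
Notation e := (e_last R n).
Implicit Types (x y v : V) (g : V -> R).

Definition foot x : V := x - x 0 ord_max *: e.

Lemma foot_boundary x : upper_boundary R n (foot x).
Proof. by rewrite /upper_boundary /foot /= -scaleNr height_up subrr. Qed.

Lemma foot_up x : foot x + x 0 ord_max *: e = x.
Proof. exact: subrK. Qed.

Lemma closure_MVT g x v (dg : V -> R) : {within closure H, continuous g} ->
  closure H x -> closure H (x + v) ->
  (forall s : R, s \in `]0, 1[ -> H (x + s *: v)) ->
  (forall y, H y -> is_derive y v g (dg y)) ->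
  exists2 s : R, s \in `]0, 1[ & g (x + v) - g x = dg (x + s *: v).
Proof.
move=> gc Hx Hxv Hs dgP.
have cs : {within `[0, 1], continuous (fun s : R => g (x + s *: v))}.
  apply: within_continuous_segment gc _ => s.
  rewrite in_itv/= => /andP[s0 s1].
  move: Hx Hxv => /closure_upperP x0 /closure_upperP; rewrite mxE => xv0.
  apply/closure_upperP; rewrite 2!mxE.
  have -> : x 0 ord_max + s * v 0 ord_max =
    (1 - s) * x 0 ord_max + s * (x 0 ord_max + v 0 ord_max) by ring.
  by rewrite addr_ge0// mulr_ge0// subr_ge0.
have ds (s : R) : s \in `]0, 1[ -> is_derive (x + s *: v) v g (dg (x + s *: v)).
  by move=> s01; apply: dgP; exact: Hs.
exact: line_MVT cs ds.
Qed.

Lemma foot_MVT g x (dg : V -> R) : {within closure H, continuous g} ->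
  (forall y, H y -> is_derive y e g (dg y)) -> H x ->
  exists2 y, H y & g x - g (foot x) = x 0 ord_max * dg y.
Proof.
move=> gc dgP Hx; have x0 : 0 < x 0 ord_max by [].
have fH := boundary_closure (foot_boundary x).
have Hs (s : R) : s \in `]0, 1[ -> H (foot x + s *: (x 0 ord_max *: e)).
  rewrite in_itv/= => /andP[s0 _]; rewrite scalerA.
  by apply: vertical_upper => //; rewrite mulr_gt0.
have dv y : H y -> is_derive y (x 0 ord_max *: e) g (x 0 ord_max * dg y).
  by move=> /dgP dy; exact: is_derive_scaled.
have fxH : closure H (foot x + x 0 ord_max *: e).
  by rewrite foot_up; exact: upper_closure.
have [s s01 E] := closure_MVT gc fH fxH Hs dv.
by rewrite foot_up in E; exists (foot x + s *: (x 0 ord_max *: e)) => //; exact: Hs.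
Qed.

End VerticalLines.

Section QuadraticBound.
Context {R : realType}.
Variables (f F : R -> R) (C : R).
Hypotheses (f_C1 : C1_real f) (F_prim : primitive F f) (F_le0 : forall t, F t <= 0).

Lemma real_MVT (g dg : R -> R) (a b : R) : (forall t : R, is_derive t 1 g (dg t)) ->
  exists2 s : R, (`|s - a| <= `|b - a|) && (`|s - b| <= `|b - a|) & g b - g a = dg s * (b - a).
Proof.
move=> gP.
have [|s s01] := @line_MVT_derive R R g a (b - a) (fun s => (b - a) * dg (a + s * (b - a))).
  move=> s _; have := is_derive_scaled (b - a) (gP (a + s *: (b - a))).
  by rewrite [(b - a) *: 1]mulr1.
have -> : a + (b - a) = b by rewrite addrC subrK.
move=> ->; exists (a + s * (b - a)); last exact: mulrC.
move: s01; rewrite in_itv/= => /andP[s0 s1].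
have -> : a + s * (b - a) - a = s * (b - a) by ring.
have -> : a + s * (b - a) - b = (s - 1) * (b - a) by ring.
have s1' : `|s - 1| = 1 - s by rewrite ler0_norm ?subr_le0 ?(ltW s1)// opprB.
rewrite !normrM (gtr0_norm s0) s1' !ler_piMl// ?(ltW s1)//.
by rewrite gerBl ltW.
Qed.

Lemma primitive_max_zero s0 : F s0 = 0 -> f s0 = 0.
Proof.
move=> Fs0; have sI : s0 \in `](s0 - 1), (s0 + 1)[.
  by rewrite in_itv/= ltrBlDr !ltrDl ltr01.
have ab : s0 - 1 <= s0 + 1 by lra.
have dF (t : R) : t \in `](s0 - 1), (s0 + 1)[ -> derivable F t 1 by move=> _; case: (F_prim t).
have mF t : t \in `](s0 - 1), (s0 + 1)[ -> F t <= F s0 by rewrite Fs0.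
have [_ d0] := derive1_at_max ab dF sI mF.
by have [_ <-] := F_prim s0.
Qed.

(** A [C^2] function is quadratically close to its maximum; this is what makes
    the first order inequality for [u] linear near a zero of [F]. *)
Lemma primitive_quadratic_bound s0 : 0 <= s0 <= C -> F s0 = 0 ->
  exists2 K : R, 0 <= K & forall s, 0 <= s <= C -> - F s <= K * (s - s0) ^+ 2.
Proof.
move=> /andP[s00 s0C] Fs0; have C0 : 0 <= C := le_trans s00 s0C.
have [K K0 KP] : exists2 K : R, 0 <= K & forall s, 0 <= s <= C -> `|derive1 f s| <= K.
  have cf : {within `[0, C], continuous (fun s : R => `|derive1 f s|)}.
    apply: within_comp; last exact: norm_continuous.
    by apply: continuous_subspaceT; exact: f_C1.2.
  have [c _ cP] := EVT_max C0 cf.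
  by exists `|derive1 f c| => // s sC; apply: cP; rewrite in_itv.
exists K => // s /andP[ss0 sC].
have df (t : R) : is_derive t 1 f (derive1 f t).
  by apply: DeriveDef; [exact: f_C1.1|rewrite derive1E].
have between (a b t : R) : `|t - a| <= `|b - a| -> `|t - b| <= `|b - a| ->
    0 <= a <= C -> 0 <= b <= C -> 0 <= t <= C.
  have [ab|ba] := leP a b.
    by rewrite (ger0_norm (x := b - a)) ?subr_ge0// !ler_norml => /andP[? ?] /andP[? ?]; lra.
  by rewrite (ltr0_norm (x := b - a)) ?subr_lt0// !ler_norml => /andP[? ?] /andP[? ?]; lra.
have [t /andP[t1 t2] E] := real_MVT s0 s F_prim.
have tC : 0 <= t <= C by apply: (between s0 s t t1 t2); apply/andP.
have [r /andP[r1 r2] E2] := real_MVT s0 t df.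
have rC : 0 <= r <= C by apply: (between s0 t r r1 r2) => //; apply/andP.
rewrite (primitive_max_zero Fs0) subr0 in E2; rewrite Fs0 subr0 in E.
apply: (le_trans (ler_norm _)); rewrite normrN E E2 !normrM -mulrA.
apply: ler_pM => //; first exact: KP.
by rewrite -real_normK ?num_real// expr2 ler_wpM2r.
Qed.

End QuadraticBound.

Section Strictness.
Context {R : realType} {n : nat}.
Notation V := 'rV[R]_n.+1.
Notation H := (upper_half_space R n).
Notation e := (e_last R n).
Variables (f F : R -> R) (kappa C : R) (u : V -> R).
Hypotheses (f_C1 : C1_real f) (F_prim : primitive F f) (F_le0 : forall t, F t <= 0).
Hypothesis F0_ge : (Num.sqrt (1 + kappa ^+ 2))^-1 - 1 <= F 0.
Hypothesis kappa_neq0 : kappa != 0.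
Hypotheses (u3 : Ck 3 H u) (u1 : C1_up_to_boundary H u).
Hypothesis u_eq : forall x, H x -> mean_curvature_op u x + f (u x) = 0.
Hypothesis u_gt0 : forall x, H x -> 0 < u x.
Hypothesis u_dirichlet : forall x, upper_boundary R n x -> u x = 0.
Hypothesis u_neumann : forall x, upper_boundary R n x ->
  has_normal_derivative u x (exterior_normal R n) kappa.
Hypothesis u_le : forall x, H x -> u x <= C.
Hypothesis grad_le : forall x, H x -> enorm (grad u x) <= C.
Implicit Types (x y v : V).

Let P_le x (Hx : H x) : energy F u x <= boundary_energy F kappa :=
  energy_le_boundary f_C1 F_prim F_le0 F0_ge u3 u1 u_eq u_gt0 u_dirichlet u_neumann
    u_le grad_le Hx.

Lemma origin_boundary : upper_boundary R n (0 : V).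
Proof. by rewrite /upper_boundary /= mxE. Qed.

Lemma kappa_lt0 : kappa < 0.
Proof.
rewrite lt_neqAle kappa_neq0 /= leNgt; apply/negP => k0.
have [r r0 rP] := boundary_quotient u_dirichlet u_neumann origin_boundary k0.
have r2 : 0 < r / 2 by rewrite divr_gt0.
have /rP : 0 < r / 2 < r by rewrite r2 ltr_pdivrMr// ltr_pMr// ltr1n.
rewrite ltNge => /negP; apply; apply: le_trans (ler_norm _).
rewrite lerDr divr_ge0 ?(ltW r2)// ltW// u_gt0//.
by apply: vertical_upper => //; exact: boundary_closure origin_boundary.
Qed.

Lemma kappa_ge : - kappa <= C.
Proof.
apply/ler_addgt0Pr => eps eps0.
have [r r0 rP] := boundary_quotient u_dirichlet u_neumann origin_boundary eps0.
have r2 : 0 < r / 2 by rewrite divr_gt0.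
have /rP : 0 < r / 2 < r by rewrite r2 ltr_pdivrMr// ltr_pMr// ltr1n.
have [s /andP[s0 _]] := vertical_MVT u1 (boundary_closure origin_boundary) r2.
rewrite (u_dirichlet origin_boundary) subr0 => ->.
have Hs : H (0 + s *: e).
  by apply: vertical_upper => //; exact: boundary_closure origin_boundary.
rewrite mulrC mulKf ?gt_eqF//.
have : grad u (0 + s *: e) 0 ord_max <= C.
  apply: (le_trans (ler_norm _)); apply: le_trans (grad_le Hs).
  by rewrite -sqrtr_sqr ler_wsqrtr// coord_sqr_le.
move: (grad u _ _ _) => a; rewrite ltr_norml => aC /andP[+ _]; lra.
Qed.

(** Equality forces [c0 = 0] and a zero [s0] of [F]; there [energy_le_boundary]
    and the quadratic bound give [|grad u| <= k |u - s0|], so that [u = s0] at one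
    point would propagate down to the boundary, where [u = 0]. *)
Lemma F_lt_boundary_energy x : H x -> F (u x) < boundary_energy F kappa.
Proof.
move=> Hx; have c0 := boundary_energy_ge0 F0_ge.
have [//|Fge] := ltP (F (u x)) (boundary_energy F kappa).
have c00 : boundary_energy F kappa = 0.
  by apply/eqP; rewrite eq_le c0 (le_trans Fge).
have Fux : F (u x) = 0 by apply/eqP; rewrite eq_le F_le0 -c00.
set s0 := u x in Fux; have s0C : 0 <= s0 <= C by rewrite u_le// ltW// u_gt0.
have [K K0 KP] := primitive_quadratic_bound f_C1 F_prim F_le0 s0C Fux.
pose M := 2 * (1 + C ^+ 2) * K.
have slope y : H y -> dot (grad u y) (grad u y) <= M * (u y - s0) ^+ 2.
  move=> Hy; have W1 := area_ge1 u y; have W2 := area_sqr u y.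
  have uC : 0 <= u y <= C by rewrite u_le// ltW// u_gt0.
  have FK := KP _ uC.
  have := P_le Hy; rewrite c00 /energy => Py.
  have NC := grad_sqr_le u_gt0 u_le grad_le Hy.
  move: (area u y) (dot (grad u y) (grad u y)) W1 W2 NC Py => W N W1 W2 NC Py.
  have W0 : 0 < W := lt_le_trans ltr01 W1.
  have NE : N = (1 - W^-1) * (W * (W + 1)).
    have -> : N = W ^+ 2 - 1 by rewrite W2 addrC addKr.
    by field; rewrite gt_eqF.
  rewrite NE.
  have -> : M * (u y - s0) ^+ 2 = (K * (u y - s0) ^+ 2) * (2 * (1 + C ^+ 2)) by rewrite /M; ring.
  apply: ler_pM.
  - by rewrite subr_ge0 invf_le1.
  - by rewrite mulr_ge0 ?addr_ge0 ?(ltW W0).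
  - by apply: le_trans FK; lra.
  - apply: (@le_trans _ _ (2 * W ^+ 2)); last by rewrite ler_pM2l// W2 lerD2l.
    by nra.
have M0 : 0 <= M by rewrite !mulr_ge0 ?addr_ge0 ?sqr_ge0.
(* Gronwall: along a vertical line [(u - s0)^2] cannot decay faster than
   exponentially, so it cannot reach zero. *)
pose g y := (u y - s0) ^+ 2 * expR ((M + 1) * y 0 ord_max).
pose dg y := (2 * (u y - s0) * grad u y 0 ord_max + (M + 1) * (u y - s0) ^+ 2) *
  expR ((M + 1) * y 0 ord_max).
have dgP y : H y -> is_derive y e g (dg y).
  move=> Hy; have du := upper_is_derive u1 e Hy; rewrite dot_e_last in du.
  have d1 := is_derive_sub du (is_derive_const y e s0).
  have d2 := @is_derive_comp R V (fun z : V => z 0 ord_max) y e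
     (fun s => expR ((M + 1) * s)) _ _ (is_derive_expR_scaled (M + 1) (y 0 ord_max))
     (is_derive_coord y e ord_max).
  have := is_derive_mul (is_derive_mul d1 d1) d2.
  have -> : e 0 ord_max = 1 by rewrite e_last_coord eqxx.
  by congr is_derive; rewrite /dg; ring.
have gc : {within closure H, continuous g}.
  have uc : {within closure H, continuous (fun y => u y - s0)}.
    by apply: within_sub; [exact: u_continuous_closure|exact: within_cst].
  apply: (within_mul (within_mul uc uc)).
  apply: (within_comp (phi := fun s => expR ((M + 1) * s)) (g := fun y : V => y 0 ord_max)).
    by apply: continuous_subspaceT => y; exact: coord_continuous.
  by move=> s; have := is_derive_expR_scaled (M + 1) s; exact: is_derive_continuous.
have [y Hy E] := foot_MVT gc dgP Hx.
have dg0 : 0 <= dg y.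
  rewrite /dg mulr_ge0 ?expR_ge0//.
  have := le_trans (coord_sqr_le (grad u y) ord_max) (slope y Hy).
  move: (grad u y 0 ord_max) (u y - s0) => a b ab.
  have : 0 <= (a + b) ^+ 2 by exact: sqr_ge0.
  by nra.
have : 0 <= g x - g (foot x) by rewrite E mulr_ge0// ltW.
rewrite /g -/s0 subrr expr0n mul0r sub0r oppr_ge0.
rewrite (u_dirichlet (foot_boundary x)) sub0r sqrrN pmulr_lle0 ?expR_gt0// => s02.
have : 0 < s0 ^+ 2 by rewrite exprn_gt0// u_gt0.
by rewrite ltNge s02.
Qed.

End Strictness.

Section Antiderivative.
Context {R : realType}.
Implicit Types (D : R -> R).

Lemma local_antiderivative D : exists Phi : R -> R, forall b : R,
  (forall t, t \in `[-1, b] -> {for t, continuous D}) ->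
  forall s : R, -1 < s < b -> is_derive s 1 Phi (D s).
Proof.
exists (fun s => \int[@lebesgue_measure R]_(t in `[-1, s]) D t)%R => b Dc s /andP[s1 sb].
have sI : s \in `[-1, b] by rewrite in_itv/= !ltW.
have Di : (@lebesgue_measure R).-integrable `[-1, b] (EFin \o D).
  apply: continuous_compact_integrable; first exact: segment_compact.
  by apply: continuous_in_subspaceT => t /set_mem; exact: Dc.
have [dPhi EPhi] := continuous_FTC1_closed sb Di s1 (Dc s sI).
apply: DeriveDef; first exact: dPhi.
rewrite -derive1E; exact: EPhi.
Qed.

End Antiderivative.

(** * The comparison profile *)

Section Profile.
Context {R : realType}.
Variables (F : R -> R) (c0 m0 : R).
Hypotheses (F_cont : continuous F) (m00 : 0 < m0) (m01 : m0 < 1).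
Implicit Types s t : R.

(** A one-dimensional solution with the boundary data satisfies
    [1 / sqrt (1 + w'^2) = 1 - c0 + F w]; [profile_cos] is this quantity,
    truncated from below at a level which the gradient bound keeps out of reach,
    and [profile_cot] is the corresponding [1 / w']. *)
Definition profile_cos s : R := Num.max (1 - c0 + F s) m0.

Definition profile_cot s : R := profile_cos s / Num.sqrt (1 - profile_cos s ^+ 2).

Lemma profile_cos_gt0 s : 0 < profile_cos s.
Proof. by rewrite lt_max m00 orbT. Qed.

Lemma profile_cos_lt1 s : F s < c0 -> profile_cos s < 1.
Proof. by move=> Fs; rewrite gt_max m01 andbT; lra. Qed.

Lemma profile_sin_gt0 s : F s < c0 -> 0 < 1 - profile_cos s ^+ 2.
Proof.
move=> /profile_cos_lt1 m1; rewrite subr_gt0 expr_lt1// ltW//.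
exact: profile_cos_gt0.
Qed.

Lemma profile_cos_continuous : continuous profile_cos.
Proof.
move=> s; apply: (@continuous_max _ _ (fun s => 1 - c0 + F s) (fun=> m0) s).
  by apply: cvgD; [exact: cvg_cst|exact: F_cont].
exact: cvg_cst.
Qed.

Lemma profile_cot_continuous s : F s < c0 -> {for s, continuous profile_cot}.
Proof.
move=> Fs; apply: cvgM; first exact: profile_cos_continuous.
apply: cvgV; first by rewrite gt_eqF// sqrtr_gt0 profile_sin_gt0.
apply: (@continuous_comp R R R (fun s => 1 - profile_cos s ^+ 2)); last exact: sqrt_continuous.
apply: cvgB; first exact: cvg_cst.
by apply: cvgM; exact: profile_cos_continuous.
Qed.

(** Extending the integrand by a constant to negative arguments makes the
    derivative at the boundary value [0] two-sided. *)
Lemma profile_antiderivative : exists Phi : R -> R, forall s, 0 <= s ->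
  (forall t, 0 <= t <= s -> F t < c0) -> is_derive s 1 Phi (profile_cot s).
Proof.
have max0c : continuous (fun t : R => Num.max t 0).
  move=> t; apply: (@continuous_max _ _ (fun t : R => t) (fun=> 0) t).
    exact: cvg_id.
  exact: cvg_cst.
have [Phi PhiP] := local_antiderivative (fun t => profile_cot (Num.max t 0)).
exists Phi => s s0 Fs.
have Fss : F s < c0 by apply: Fs; rewrite s0 lexx.
have [r r0 rP] : exists2 r : R, 0 < r & forall t, `|t - s| < r -> F t < c0.
  have d0 : 0 < c0 - F s by rewrite subr_gt0.
  have cF : F t @[t --> s] --> F s by exact: F_cont.
  move: cF => /cvgrPdist_lt /(_ _ d0) /nbhs_ballP[r r0 rP]; exists r => // t ts.
  have := rP t; rewrite -ball_normE /= distrC => /(_ ts).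
  by rewrite ltr_norml => /andP[+ _]; lra.
have sb : -1 < s < s + r / 2.
  by rewrite ltrDl divr_gt0// andbT (lt_le_trans _ s0)// oppr_lt0 ltr01.
have := PhiP (s + r / 2) _ s sb; rewrite (max_idPl s0); apply => t.
rewrite in_itv/= => /andP[t1 t2].
apply: (@continuous_comp R R R (fun t => Num.max t 0)); first exact: max0c.
apply: profile_cot_continuous; have [t0|t0] := leP t 0.
  by apply: Fs; rewrite lexx s0.
have [ts|st] := leP t s; first by apply: Fs; rewrite (ltW t0).
apply: rP; rewrite gtr0_norm ?subr_gt0// ltrBlDl (le_lt_trans t2)// ltrD2l.
by rewrite ltr_pdivrMr// ltr_pMr// ltr1n.
Qed.

End Profile.

(** * A scalar inequality for the boundary point lemma *)

(** The second derivative test behind the boundary point lemma. With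
    [c = 1 / W] and [m] the profile cosine, the zero-order terms combine to
    [(m (1 - m^2) - c (1 - c^2))] times a bounded factor; they vanish for [m = c],
    so the excess [1 - D^2 N] of the eikonal inequality controls them. *)
Lemma hopf_scalar (R : realFieldType) (k al qq qp qn Q N W m s fu K d : R) :
  0 < k -> 0 <= al -> 0 < W -> W ^+ 2 = 1 + N -> 0 < m -> m <= W^-1 -> 0 < s ->
  s ^+ 2 = 1 - m ^+ 2 -> `|fu| <= K -> 0 <= N -> qp ^+ 2 <= qq * N -> qn <= Q ->
  1 - (m / s) ^+ 2 * N <= 2 * k * qn ->
  k * (al * (qq - qp ^+ 2 / W ^+ 2) - 2 * (d - N / W ^+ 2)) <=
    m / s * fu * W - fu / s ^+ 3 * (N / W ^+ 2) ->
  al * qq / W ^+ 2 - 2 * d <= 4 * K * Q / s.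
Proof.
move=> k0 al0 W0 W2 m0 mW s0 s2 fK N0 CS qQ g_le test.
pose c := W^-1; have c0 : 0 < c by rewrite invr_gt0.
have WE : W = c^-1 by rewrite /c invrK.
have NE : N = c^-1 ^+ 2 - 1 by rewrite -WE W2 addrC addKr.
have cn : c != 0 by rewrite gt_eqF.
have sn : s != 0 by rewrite gt_eqF.
rewrite -/c in mW.
have c1 : c <= 1.
  rewrite /c invf_le1// -ler_sqr ?nnegrE ?(ltW W0)//.
  by rewrite expr1n W2 lerDl.
set g := 1 - (m / s) ^+ 2 * N in g_le.
have gE : g * (s ^+ 2 * c ^+ 2) = (c - m) * (c + m).
  have -> : (c - m) * (c + m) = s ^+ 2 * c ^+ 2 - m ^+ 2 * (1 - c ^+ 2).
    by rewrite s2; ring.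
  by rewrite /g NE; field; rewrite cn sn.
have XE : m / s * fu * W - fu / s ^+ 3 * (N / W ^+ 2) =
    fu * ((m * (1 - m ^+ 2) - c * (1 - c ^+ 2)) / (c * s ^+ 3)).
  by rewrite -s2 NE WE; field; rewrite cn sn.
have cm0 : 0 < c + m by rewrite addr_gt0.
have g0 : 0 <= g.
  have sc : 0 < s ^+ 2 * c ^+ 2 by rewrite mulr_gt0 ?exprn_gt0.
  by rewrite -(pmulr_lge0 _ sc) gE mulr_ge0 ?subr_ge0// ltW.
have cmg : c - m <= g * s ^+ 2 * c.
  rewrite -(ler_pM2r cm0) -gE [leLHS](_ : _ = g * s ^+ 2 * c * c); last by ring.
  by rewrite ler_wpM2l ?lerDl ?(ltW m0)// !mulr_ge0// ?exprn_ge0 ltW.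
have Xb : `|(m * (1 - m ^+ 2) - c * (1 - c ^+ 2)) / (c * s ^+ 3)| <= 2 * g / s.
  have cs3 : 0 < c * s ^+ 3 by rewrite mulr_gt0// exprn_gt0.
  rewrite normrM normfV (gtr0_norm cs3) ler_pdivrMr//.
  have -> : 2 * g / s * (c * s ^+ 3) = (g * s ^+ 2 * c) * 2 by field.
  have -> : m * (1 - m ^+ 2) - c * (1 - c ^+ 2) =
     (m - c) * (1 - (m ^+ 2 + m * c + c ^+ 2)) by ring.
  rewrite normrM; apply: ler_pM => //.
    by rewrite distrC ger0_norm ?subr_ge0.
  have m1 : m <= 1 := le_trans mW c1.
  have b1 : 0 <= m ^+ 2 <= 1 by rewrite sqr_ge0 expr_le1// ltW.
  have b2 : 0 <= m * c <= 1 by rewrite mulr_ge0 ?mulr_ile1// ltW.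
  have b3 : 0 <= c ^+ 2 <= 1 by rewrite sqr_ge0 expr_le1// ltW.
  by rewrite ler_norml; lra.
have K0 : 0 <= K := le_trans (normr_ge0 _) fK.
have rhs : m / s * fu * W - fu / s ^+ 3 * (N / W ^+ 2) <= k * (4 * K * Q / s).
  rewrite XE; apply: (le_trans (ler_norm _)); rewrite normrM.
  apply: (le_trans (ler_pM (normr_ge0 _) (normr_ge0 _) fK Xb)).
  rewrite [leLHS](_ : _ = K / s * 2 * g); last by ring.
  rewrite [leRHS](_ : _ = K / s * 2 * (2 * k * Q)); last by ring.
  rewrite ler_wpM2l ?mulr_ge0 ?invr_ge0 ?(ltW s0)//.
  by apply: (le_trans g_le); rewrite ler_wpM2l// mulr_ge0// ltW.
have : k * (al * qq / W ^+ 2 - 2 * d) <= k * (4 * K * Q / s).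
  apply: le_trans rhs; apply: le_trans test; rewrite ler_wpM2l ?(ltW k0)//.
  have W2p : 0 < W ^+ 2 by rewrite exprn_gt0.
  have h1 : al * qq / W ^+ 2 <= al * (qq - qp ^+ 2 / W ^+ 2).
    rewrite -mulrA ler_wpM2l// ler_pdivrMr// mulrBl divfK ?gt_eqF//.
    by rewrite W2; lra.
  have h2 : 0 <= N / W ^+ 2 by rewrite divr_ge0// ltW.
  by lra.
by rewrite ler_pM2l.
Qed.

(** * The gap between height and profile *)

Section Gap.
Context {R : realType} {n : nat}.
Notation V := 'rV[R]_n.+1.
Notation H := (upper_half_space R n).
Notation e := (e_last R n).
Variables (f F : R -> R) (kappa C : R) (u : V -> R).
Hypotheses (f_C1 : C1_real f) (F_prim : primitive F f) (F_le0 : forall t, F t <= 0).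
Hypothesis F0_ge : (Num.sqrt (1 + kappa ^+ 2))^-1 - 1 <= F 0.
Hypothesis kappa_neq0 : kappa != 0.
Hypotheses (u3 : Ck 3 H u) (u1 : C1_up_to_boundary H u).
Hypothesis u_eq : forall x, H x -> mean_curvature_op u x + f (u x) = 0.
Hypothesis u_gt0 : forall x, H x -> 0 < u x.
Hypothesis u_dirichlet : forall x, upper_boundary R n x -> u x = 0.
Hypothesis u_neumann : forall x, upper_boundary R n x ->
  has_normal_derivative u x (exterior_normal R n) kappa.
Hypothesis u_le : forall x, H x -> u x <= C.
Hypothesis grad_le : forall x, H x -> enorm (grad u x) <= C.
Implicit Types (x y v : V).

Local Notation c0 := (boundary_energy F kappa).

(** Strictly below every value of [1 / area u], so that the truncation in
    [profile_cos] is inactive wherever [profile_cos (u x) = 1 / area u x]. *)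
Definition cos_floor : R := (2 * Num.sqrt (1 + C ^+ 2))^-1.
Local Notation m0 := cos_floor.
Local Notation pcos := (profile_cos F c0 m0).
Local Notation pcot := (profile_cot F c0 m0).

Lemma sqrt1C_ge1 : 1 <= Num.sqrt (1 + C ^+ 2).
Proof. by rewrite -[leLHS]sqrtr1 ler_wsqrtr// lerDl sqr_ge0. Qed.

Lemma cos_floor_gt0 : 0 < m0.
Proof. by rewrite invr_gt0 mulr_gt0// (lt_le_trans _ sqrt1C_ge1). Qed.

Lemma cos_floor_lt : m0 < (Num.sqrt (1 + C ^+ 2))^-1.
Proof.
have s0 : 0 < Num.sqrt (1 + C ^+ 2) := lt_le_trans ltr01 sqrt1C_ge1.
by rewrite ltf_pV2 ?posrE ?mulr_gt0// ltr_pMl// ltr1n.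
Qed.

Lemma cos_floor_lt1 : m0 < 1.
Proof.
apply: (lt_le_trans cos_floor_lt); rewrite invf_le1 ?sqrt1C_ge1//.
exact: lt_le_trans ltr01 sqrt1C_ge1.
Qed.

Lemma cos_floor_lt_area x : H x -> m0 < (area u x)^-1.
Proof.
move=> Hx; apply: (lt_le_trans cos_floor_lt).
have s0 : 0 < Num.sqrt (1 + C ^+ 2) := lt_le_trans ltr01 sqrt1C_ge1.
rewrite lef_pV2 ?posrE ?area_gt0// ler_wsqrtr// lerD2l.
exact: (grad_sqr_le u_gt0 u_le grad_le Hx).
Qed.

Lemma profile_cos_le x : H x -> pcos (u x) <= (area u x)^-1.
Proof.
move=> Hx; rewrite ge_max (ltW (cos_floor_lt_area Hx)) andbT.
have := energy_le_boundary f_C1 F_prim F_le0 F0_ge u3 u1 u_eq u_gt0 u_dirichlet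
  u_neumann u_le grad_le Hx.
by rewrite /energy; lra.
Qed.

Lemma F0_lt : F 0 < c0.
Proof.
rewrite /boundary_energy -addrA ltrDl subr_gt0 invf_lt1; last first.
  by rewrite sqrtr_gt0 ltr_wpDr// sqr_ge0.
by rewrite -[ltLHS]sqrtr1 ltr_sqrt ?ltrDl ?ltr_wpDr ?sqr_ge0// exprn_even_gt0.
Qed.

Lemma F_lt_closure x : closure H x -> F (u x) < c0.
Proof.
move=> /closure_upperP; rewrite le_eqVlt => /orP[/eqP/esym x0|Hx].
  by rewrite (u_dirichlet x0) F0_lt.
exact: (F_lt_boundary_energy f_C1 F_prim F_le0 F0_ge u3 u1 u_eq u_gt0 u_dirichlet
  u_neumann u_le grad_le Hx).
Qed.

Lemma u_ge0 x : closure H x -> 0 <= u x.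
Proof.
move=> /closure_upperP; rewrite le_eqVlt => /orP[/eqP/esym x0|Hx].
  by rewrite (u_dirichlet x0).
by rewrite ltW// u_gt0.
Qed.

Lemma F_lt_range x t : closure H x -> 0 <= t <= u x -> F t < c0.
Proof.
move=> Hx /andP[t0 tu]; have x0 : 0 <= x 0 ord_max by exact/closure_upperP.
have Hs (s : R) : s \in `[0, 1] -> closure H (foot x + s *: (x 0 ord_max *: e)).
  rewrite in_itv/= => /andP[s0 _]; apply/closure_upperP.
  by rewrite scalerA height_up (foot_boundary x) add0r mulr_ge0.
have cs := within_continuous_segment (u_continuous_closure u1) Hs.
have [] := @IVT R _ 0 1 t ler01 cs.
  rewrite scale0r scale1r addr0 foot_up (u_dirichlet (foot_boundary x)).
  by rewrite (min_idPl (u_ge0 Hx)) (max_idPr (u_ge0 Hx)) t0.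
by move=> s s01 <-; apply: F_lt_closure; exact: Hs.
Qed.

Variable Phi : R -> R.
Hypothesis PhiP : forall s, 0 <= s ->
  (forall t, 0 <= t <= s -> F t < c0) -> is_derive s 1 Phi (pcot s).

Lemma is_derive_Phi x : closure H x -> is_derive (u x) 1 Phi (pcot (u x)).
Proof. by move=> Hx; apply: PhiP; [exact: u_ge0|move=> t; exact: F_lt_range]. Qed.

(** Height minus the height at which the profile takes the value [u x]. *)
Definition gap x : R := x 0 ord_max - (Phi (u x) - Phi 0).

Definition dgap v x : R := v 0 ord_max - pcot (u x) * dot v (grad u x).

Lemma is_derive_gap x v : H x -> is_derive x v gap (dgap v x).
Proof.
move=> Hx; have d1 := is_derive_comp (is_derive_Phi (upper_closure Hx)) (upper_is_derive u1 v Hx).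
have := is_derive_sub (is_derive_coord x v ord_max) (is_derive_sub d1 (is_derive_const x v (Phi 0))).
by rewrite subr0.
Qed.

Lemma gap_continuous : {within closure H, continuous gap}.
Proof.
apply: within_sub; last apply: within_sub; last exact: within_cst.
  by apply: continuous_subspaceT => y; exact: coord_continuous.
apply: within_comp_local (u_continuous_closure u1) _ => y /is_derive_Phi.
exact: is_derive_continuous.
Qed.

Lemma gap_boundary x : upper_boundary R n x -> gap x = 0.
Proof. by move=> x0; rewrite /gap (u_dirichlet x0) subrr subr0. Qed.

(** The eikonal form of the energy bound: [Phi \o u] is 1-Lipschitz. *)
Lemma cot_grad_le1 x : H x -> pcot (u x) ^+ 2 * dot (grad u x) (grad u x) <= 1.
Proof.
move=> Hx; have Fx := F_lt_closure (upper_closure Hx).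
have s2 := profile_sin_gt0 cos_floor_gt0 cos_floor_lt1 Fx.
have mW := profile_cos_le Hx; have W0 := area_gt0 u x; have W2 := area_sqr u x.
have m00 := profile_cos_gt0 F c0 cos_floor_gt0 (u x).
rewrite /profile_cot expr_div_n sqr_sqrtr ?(ltW s2)// mulrAC ler_pdivrMr// mul1r.
have -> : dot (grad u x) (grad u x) = area u x ^+ 2 - 1 by rewrite W2 addrC addKr.
rewrite mulrBr mulr1 lerD2r -exprMn expr_le1//; last by rewrite mulr_ge0// ltW.
by rewrite -ler_pdivlMr// mul1r.
Qed.

Lemma gap_ge0 x : closure H x -> 0 <= gap x.
Proof.
move=> /closure_upperP; rewrite le_eqVlt => /orP[/eqP/esym x0|Hx].
  by rewrite (gap_boundary x0).
have [y Hy] := foot_MVT gap_continuous (fun y Hy => is_derive_gap e Hy) Hx.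
rewrite (gap_boundary (foot_boundary x)) subr0 => ->.
rewrite mulr_ge0 ?(ltW Hx)// /dgap dot_e_last e_last_coord eqxx subr_ge0.
apply: (le_trans (ler_norm _)); rewrite -[leRHS]sqrtr1 -sqrtr_sqr ler_wsqrtr//.
apply: le_trans (cot_grad_le1 Hy); rewrite exprMn ler_wpM2l ?sqr_ge0//.
exact: coord_sqr_le.
Qed.

Lemma profile_cos0 : pcos 0 = (Num.sqrt (1 + kappa ^+ 2))^-1.
Proof.
have k0 := kappa_lt0 kappa_neq0 u_gt0 u_dirichlet u_neumann.
have kC := kappa_ge u1 u_dirichlet u_neumann grad_le.
rewrite /profile_cos /boundary_energy.
have -> : 1 - (F 0 + 1 - (Num.sqrt (1 + kappa ^+ 2))^-1) + F 0 =
  (Num.sqrt (1 + kappa ^+ 2))^-1 by ring.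
apply/max_idPl; apply: (le_trans (ltW cos_floor_lt)).
rewrite lef_pV2 ?posrE ?sqrtr_gt0 ?ltr_wpDr ?sqr_ge0//.
rewrite ler_wsqrtr// lerD2l -sqrrN lerXn2r ?nnegrE ?oppr_ge0 ?(ltW k0)//.
by rewrite (le_trans _ kC)// oppr_ge0 ltW.
Qed.

Lemma profile_cot0 : pcot 0 * - kappa = 1.
Proof.
have k0 := kappa_lt0 kappa_neq0 u_gt0 u_dirichlet u_neumann.
rewrite /profile_cot profile_cos0; set S := Num.sqrt (1 + _).
have S0 : 0 < S by rewrite sqrtr_gt0 ltr_wpDr ?sqr_ge0.
have S2 : S ^+ 2 = 1 + kappa ^+ 2 by rewrite sqr_sqrtr// addr_ge0 ?sqr_ge0.
have -> : 1 - S^-1 ^+ 2 = (- kappa / S) ^+ 2.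
  have -> : (- kappa / S) ^+ 2 = kappa ^+ 2 / S ^+ 2 by rewrite expr_div_n sqrrN.
  have -> : kappa ^+ 2 = S ^+ 2 - 1 by rewrite S2 addrC addKr.
  by field; rewrite gt_eqF.
rewrite sqrtr_sqr ger0_norm; last by rewrite divr_ge0 ?oppr_ge0 ?(ltW k0) ?(ltW S0).
by field; rewrite kappa_neq0 gt_eqF.
Qed.

Lemma is_derive_profile_cot s : m0 < pcos s -> F s < c0 ->
  is_derive s 1 pcot (f s / Num.sqrt (1 - pcos s ^+ 2) ^+ 3).
Proof.
move=> ms Fs; have s2 := profile_sin_gt0 cos_floor_gt0 cos_floor_lt1 Fs.
pose M t := 1 - c0 + F t.
have ME t : m0 < M t -> pcos t = M t by move=> mt; apply/max_idPl; exact: ltW.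
have mM : m0 < M s by move: ms; rewrite lt_max ltxx orbF.
rewrite (ME _ mM) in s2 *.
have dM : is_derive s 1 M (f s).
  by have := is_derive_add (is_derive_const s 1 (1 - c0)) (F_prim s); rewrite add0r.
have dS2 := is_derive_sub (is_derive_const s 1 1) (is_derive_mul dM dM).
have s2' : 0 < 1 - M s * M s by rewrite -expr2.
have dS := @is_derive_comp R R (fun t => 1 - M t * M t) s 1 Num.sqrt _ _
  (is_derive1_sqrt s2') dS2.
have S0 : 0 < Num.sqrt (1 - M s * M s) by rewrite sqrtr_gt0.
have Sn : Num.sqrt (1 - M s * M s) != 0 by rewrite gt_eqF.
have dV := @is_derive_inv R R (fun t => Num.sqrt (1 - M t * M t)) s 1 _ Sn dS.
have dP := is_derive_mul dM dV.
have nearE : {near s, (fun t => M t / Num.sqrt (1 - M t * M t)) =1 pcot}.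
  have Mc : {for s, continuous M} by exact: is_derive_continuous dM.
  have : \forall t \near s, m0 < M t by exact: (cvgr_gt (M s) Mc).
  by apply: filterS => t mt; rewrite /profile_cot (ME _ mt) expr2.
have := near_eq_is_derive nearE dP.
congr is_derive; rewrite expr2.
set S := Num.sqrt _ in S0 Sn *.
have SE : S ^+ 2 = 1 - M s * M s by rewrite sqr_sqrtr// ltW.
have -> : M s * - ((2 * S)^-1 * (0 - (f s * M s + M s * f s)) / S ^+ 2) =
   f s * (M s * M s) / S ^+ 3 by field.
have -> : M s * M s = 1 - S ^+ 2 by rewrite SE; ring.
by field.
Qed.

(** * The boundary point lemma *)

Section HopfBarrier.
Variables (ys b : V) (al eps : R).
Hypotheses (al0 : 0 < al) (eps0 : 0 < eps).

(** This is [r^2 - |y - c|^2] for the center [c] and the radius [r] of the ball with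
    diameter from [ys] to [ys + b]. *)
Definition lens y : R := dot (y - ys) b - dot (y - ys) (y - ys).

Definition bump y : R := expR (al * lens y) - 1.

Definition normal y : V := b - 2 *: (y - ys).

Lemma is_derive_lens y v : is_derive y v lens (dot v (normal y)).
Proof.
have dsub i : is_derive y v (fun z : V => (z - ys) 0 i) (v 0 i).
  have := is_derive_sub (is_derive_coord y v i) (is_derive_const y v (ys 0 i)).
  rewrite subr0; congr is_derive; apply/funext => z; by rewrite !mxE.
have d1 : is_derive y v (fun z => dot (z - ys) b) (dot v b).
  apply: is_derive_bigsum => i.
  by have := is_derive_mul (dsub i) (is_derive_const y v (b 0 i)); rewrite mulr0 addr0.
have d2 : is_derive y v (fun z => dot (z - ys) (z - ys)) (2 * dot v (y - ys)).
  rewrite mulr_sumr; apply: is_derive_bigsum => i.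
  by have := is_derive_mul (dsub i) (dsub i); congr is_derive; ring.
have := is_derive_sub d1 d2; congr is_derive.
by rewrite /normal !(dotBr, dotZr).
Qed.

Lemma is_derive_bump y v :
  is_derive y v bump (al * expR (al * lens y) * dot v (normal y)).
Proof.
have := is_derive_sub (@is_derive_comp R V lens y v (fun s => expR (al * s)) _ _
  (is_derive_expR_scaled al (lens y)) (is_derive_lens y v)) (is_derive_const y v 1).
by rewrite subr0.
Qed.

Lemma is_derive_dot_normal y v : is_derive y v (fun z => dot v (normal z)) (- (2 * dot v v)).
Proof.
have -> : (fun z => dot v (normal z)) = (fun z => dot v (b + 2 *: ys) - 2 * dot v z).
  by apply/funext => z; rewrite /normal !(dotDr, dotNr, dotZr); ring.
have := is_derive_sub (is_derive_const y v (dot v (b + 2 *: ys)))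
  (is_derive_mul (is_derive_const y v 2) (is_derive_dotr y v v)).
by congr is_derive; ring.
Qed.

(** At an interior minimum of [gap - eps * bump] the gradient of the gap is a
    multiple of that of the bump, which bounds [1 - |grad (Phi \o u)|^2] and with
    it the zero-order terms; hence [al] cannot be large. *)
Lemma hopf_test x0 K Q : H x0 -> m0 < pcos (u x0) ->
  (\forall y \near x0, gap x0 - eps * bump x0 <= gap y - eps * bump y) ->
  `|f (u x0)| <= K -> normal x0 0 ord_max <= Q ->
  al * dot (normal x0) (normal x0) / area u x0 ^+ 2 - 2 * n.+1%:R <=
  4 * K * Q / Num.sqrt (1 - pcos (u x0) ^+ 2).
Proof.
move=> Hx0 ms xmin fK qQ; have Fx0 := F_lt_closure (upper_closure Hx0).
have s2 := profile_sin_gt0 cos_floor_gt0 cos_floor_lt1 Fx0.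
set s := Num.sqrt (1 - pcos (u x0) ^+ 2).
have s0 : 0 < s by rewrite sqrtr_gt0.
have sE : s ^+ 2 = 1 - pcos (u x0) ^+ 2 by rewrite sqr_sqrtr// ltW.
have u2 : Ck 2 H u := CkW u3.
pose E := expR (al * lens x0); have E0 : 0 < E := expR_gt0 _.
pose k := eps * al * E.
have k0 : 0 < k by rewrite !mulr_gt0.
pose dQ v y := eps * (al * expR (al * lens y) * dot v (normal y)) - dgap v y.
pose M : 'M[R]_n.+1 := (f (u x0) / s ^+ 3) *: ((grad u x0)^T *m grad u x0)
  + pcot (u x0) *: hess u x0
  + k *: (al *: ((normal x0)^T *m normal x0) - 2 *: 1%:M).
have test v : dQ v x0 = 0 /\ quad M v <= 0.
  have dQP : \forall y \near x0, is_derive y v (fun y => eps * bump y - gap y) (dQ v y).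
    have := open_nbhs_nbhs (conj open_upper Hx0); apply: filterS => y Hy.
    have := is_derive_sub (is_derive_mul (is_derive_const y v eps) (is_derive_bump y v))
      (is_derive_gap v Hy).
    by congr is_derive; rewrite /dQ; ring.
  have xmax : \forall y \near x0, eps * bump y - gap y <= eps * bump x0 - gap x0.
    by apply: filterS xmin => y; lra.
  apply: (line_second_derivative_at_max xmax dQP).
  have dE := @is_derive_comp R V lens x0 v (fun s => expR (al * s)) _ _
    (is_derive_expR_scaled al (lens x0)) (is_derive_lens x0 v).
  have d1 := is_derive_mul (is_derive_mul (is_derive_const x0 v al) dE)
    (is_derive_dot_normal x0 v).
  have dcot := @is_derive_comp R V u x0 v pcot _ _
    (is_derive_profile_cot ms Fx0) (upper_is_derive u1 v Hx0).
  have d2 := is_derive_mul dcot (is_derive_dot_grad v v open_upper u2 Hx0).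
  have := is_derive_sub (is_derive_mul (is_derive_const x0 v eps) d1)
    (is_derive_sub (is_derive_const x0 v (v 0 ord_max)) d2).
  congr is_derive; rewrite /M !(bilD, bilN, bilZ) !bil_outer quad_1 /k /E -/s; ring.
have first v : k * dot v (normal x0) = v 0 ord_max - pcot (u x0) * dot v (grad u x0).
  by have [+ _] := test v; rewrite /dQ /dgap -/E /k => d0; lra.
have S0 : \sum_(i < n.+1) quad M (mc_frame (grad u x0) i) <= 0.
  by apply: sumr_le0 => i _; have [] := test (mc_frame (grad u x0) i).
rewrite sum_quad_mc_frame -area_sqr in S0.
have Et := cleared_eq0 open_upper u3 u_eq Hx0; rewrite /cleared_eq in Et.
move: S0; rewrite /M !(bilD, bilN, bilZ) !bil_outer quad_1.
rewrite !(mxtraceD, mxtraceN, mxtraceZ) !trace_outer mxtrace1 => S0.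
have W0 := area_gt0 u x0; have W2 := area_sqr u x0.
have mW := profile_cos_le Hx0.
have CS := CauchySchwarz (normal x0) (grad u x0).
have g_le : 1 - (pcos (u x0) / s) ^+ 2 * dot (grad u x0) (grad u x0) <=
    2 * k * normal x0 0 ord_max.
  have f1 := first (grad u x0); have f2 := first (normal x0); have f3 := first e.
  rewrite !dot_e_last e_last_coord eqxx in f3.
  rewrite (dotC (normal x0) (grad u x0)) in f2.
  rewrite -[pcos (u x0) / s]/(pcot (u x0)).
  have qq0 := dotxx_ge0 (normal x0).
  move: (pcot (u x0)) (dot (grad u x0) (grad u x0)) (normal x0 0 ord_max)
    (grad u x0 0 ord_max) (dot (grad u x0) (normal x0)) (dot (normal x0) (normal x0))
    f1 f2 f3 qq0 => D N qn pn X qq f1 f2 f3 qq0.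
  have a1 : D * N = pn - k * X by lra.
  have a2 : D * pn = 1 - k * qn by move: f3; rewrite mulr1n; lra.
  have a3 : D * X = qn - k * qq by lra.
  have -> : D ^+ 2 * N = D * pn - k * (D * X).
    by rewrite expr2 -mulrA a1; ring.
  rewrite a2 a3.
  have -> : 1 - (1 - k * qn - k * (qn - k * qq)) = 2 * k * qn - k ^+ 2 * qq by ring.
  by rewrite gerBl mulr_ge0// sqr_ge0.
apply: (hopf_scalar k0 (ltW al0) W0 W2 (profile_cos_gt0 F c0 cos_floor_gt0 (u x0)) mW s0
  sE fK (dotxx_ge0 _) CS qQ g_le).
have Wn := area_neq0 u x0.
rewrite -[pcos (u x0) / s]/(pcot (u x0)) (dotC (normal x0) (grad u x0)).
have sn : s != 0 by rewrite gt_eqF.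
move: S0 Et W2 Wn; rewrite -?/s.
move: (\tr (hess u x0)) (quad (hess u x0) (grad u x0)) (area u x0) (pcot (u x0))
  (dot (grad u x0) (grad u x0)) (dot (grad u x0) (normal x0))
  (dot (normal x0) (normal x0)) (f (u x0)) => t A W D N X qq fu S0 Et W2 Wn.
have NE : N = W ^+ 2 - 1 by rewrite W2 addrC addKr.
have tE : t = (A - fu * W ^+ 3) / W ^+ 2.
  apply: (mulfI (expf_neq0 2 Wn)); rewrite [RHS]mulrC divfK ?expf_neq0//.
  by apply/eqP; rewrite -subr_eq0 -[X in _ == X]Et; apply/eqP; ring.
rewrite -subr_le0; apply: le_trans S0; rewrite le_eqVlt; apply/orP; left; apply/eqP.
by rewrite tE NE; field; rewrite Wn sn.
Qed.

End HopfBarrier.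

Section Contact.
Variable G : V -> V.
Hypothesis Gc : forall i, {within closure H, continuous (fun x => G x 0 i)}.
Hypothesis GE : forall x, H x -> G x = grad u x.
Hypothesis Gb : forall y, upper_boundary R n y -> G y = - kappa *: e.

Definition dgap_closure v x : R := v 0 ord_max - pcot (u x) * dot v (G x).

Lemma profile_cos_u_continuous : {within closure H, continuous (fun x => pcos (u x))}.
Proof.
apply: (within_comp (u_continuous_closure u1)).
by apply: profile_cos_continuous; exact: F_continuous F_prim.
Qed.

Lemma dgap_closure_continuous v : {within closure H, continuous (dgap_closure v)}.
Proof.
apply: within_sub; first exact: within_cst.
apply: within_mul.
  apply: within_comp_local (u_continuous_closure u1) _ => y Hy.
  apply: profile_cot_continuous; [exact: F_continuous F_prim|exact: cos_floor_gt0| |].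
    exact: cos_floor_lt1.
  exact: F_lt_closure.
by apply: within_bigsum => i; apply: within_mul; [exact: within_cst|exact: Gc].
Qed.

(** Where the gap vanishes its gradient does too: inside because the gap is
    nonnegative, on the boundary because of the overdetermined data. *)
Lemma contact_slope y : closure H y -> gap y = 0 ->
  m0 < pcos (u y) /\ forall v, dgap_closure v y = 0.
Proof.
move=> /closure_upperP; rewrite le_eqVlt => /orP[/eqP/esym y0|Hy] gy0.
  split.
    rewrite (u_dirichlet y0) profile_cos0; apply: (lt_le_trans cos_floor_lt).
    have kC := kappa_ge u1 u_dirichlet u_neumann grad_le.
    have k0 := kappa_lt0 kappa_neq0 u_gt0 u_dirichlet u_neumann.
    rewrite lef_pV2 ?posrE ?sqrtr_gt0 ?ltr_wpDr ?sqr_ge0//.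
    rewrite ler_wsqrtr// lerD2l -sqrrN lerXn2r ?nnegrE ?oppr_ge0 ?(ltW k0)//.
    by rewrite (le_trans _ kC)// oppr_ge0 ltW.
  move=> v; rewrite /dgap_closure (Gb y0) (u_dirichlet y0) dotZr mulrA profile_cot0 mul1r.
  by rewrite dotC dot_e_last subrr.
have slope v : dgap v y = 0.
  have gmax : \forall z \near y, - gap z <= - gap y.
    have := open_nbhs_nbhs (conj open_upper Hy); apply: filterS => z Hz.
    by rewrite gy0 oppr0 oppr_le0 gap_ge0//; exact: upper_closure.
  have gd : \forall z \near y, is_derive z v (fun z => - gap z) (- dgap v z).
    have := open_nbhs_nbhs (conj open_upper Hy); apply: filterS => z Hz.
    have := is_derive_sub (is_derive_const z v 0) (is_derive_gap v Hz).
    by rewrite sub0r; under eq_fun do rewrite sub0r.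
  by have /eqP := line_first_derivative_at_max gmax gd; rewrite oppr_eq0 => /eqP.
split; last by move=> v; rewrite /dgap_closure GE//; exact: slope.
have f1 := slope (grad u y); have f2 := slope e; rewrite /dgap in f1 f2.
rewrite dot_e_last e_last_coord eqxx in f2.
suff -> : pcos (u y) = (area u y)^-1 by exact: cos_floor_lt_area.
have s2 := profile_sin_gt0 cos_floor_gt0 cos_floor_lt1 (F_lt_closure (upper_closure Hy)).
have c0' := profile_cos_gt0 F c0 cos_floor_gt0 (u y).
have W0 := area_gt0 u y; have W2 := area_sqr u y.
have D2 : pcot (u y) ^+ 2 * dot (grad u y) (grad u y) = 1.
  move: f1 f2; move: (pcot (u y)) (dot (grad u y) (grad u y)) (grad u y 0 ord_max).
  move=> D N pn f1 f2; rewrite expr2 -mulrA.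
  have -> : D * N = pn by lra.
  by move: f2; rewrite mulr1n; lra.
move: D2; rewrite /profile_cot expr_div_n sqr_sqrtr ?(ltW s2)//.
have -> : dot (grad u y) (grad u y) = area u y ^+ 2 - 1 by rewrite W2 addrC addKr.
move: (pcos (u y)) (area u y) c0' W0 s2 => m W m_gt0 W0 s2 E.
have mW : (m * W) ^+ 2 = 1.
  have : m ^+ 2 * (W ^+ 2 - 1) = 1 - m ^+ 2.
    have -> : m ^+ 2 * (W ^+ 2 - 1) =
        (m ^+ 2 / (1 - m ^+ 2) * (W ^+ 2 - 1)) * (1 - m ^+ 2).
      by field; rewrite gt_eqF.
    by rewrite E mul1r.
  by rewrite exprMn; lra.
apply: (mulIf (lt0r_neq0 W0)); rewrite mulVf ?gt_eqF//.
by apply/eqP; rewrite -(@eqrXn2 _ 2) ?mulr_ge0 ?(ltW W0) ?(ltW m_gt0)// mW expr1n.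
Qed.

Lemma closed_contact : closed (closure H `&` [set y | gap y = 0]).
Proof.
move=> y yB; have yH : closure H y.
  have : closure (closure H) y by apply: closure_subset yB => z [].
  by rewrite -(closure_id _).1//; exact: closed_closure.
split=> //=; apply/eqP/negPn/negP => gy; have g0 : 0 < `|gap y| by rewrite normr_gt0.
have [r r0 rP] := (within_continuousP _ _).1 gap_continuous y yH _ g0.
have [|z [[zH gz] zr]] := yB [set z | `|z - y| < r].
  by apply/nbhs_normP; exists r.
by have := rP z zH zr; rewrite gz sub0r normrN ltxx.
Qed.

(** A ball free of zeros of the gap with a zero on its boundary; the foot of
    [x1] keeps the ball inside the half-space. *)
Lemma nearest_contact x1 : H x1 -> gap x1 != 0 ->
  exists y, [/\ closure H y, gap y = 0, 0 < dot (x1 - y) (x1 - y),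
    dot (x1 - y) (x1 - y) <= (x1 0 ord_max) ^+ 2 &
    forall x, dot (x - x1) (x - x1) < dot (x1 - y) (x1 - y) -> H x /\ 0 < gap x].
Proof.
move=> Hx1 gx1; pose h := x1 0 ord_max.
have h0 : 0 < h by [].
have dsym x y : dot (x - y) (x - y) = dot (y - x) (y - x).
  by rewrite -opprB dotNl dotNr opprK.
pose B := [set y : V | dot (y - x1) (y - x1) <= h ^+ 2] `&`
  (closure H `&` [set y | gap y = 0]).
have cB : compact B.
  by apply: compact_closedI closed_contact; exact: compact_dot_le.
have Bf : B (foot x1).
  split; last first.
    split; first exact: boundary_closure (foot_boundary x1).
    exact: gap_boundary (foot_boundary x1).
  rewrite /= dsym /foot opprB addrCA subrr addr0 dotZl dotZr dot_e_last_e_last.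
  by rewrite mulr1 expr2.
have dc : {within B, continuous (fun y : V => dot (y - x1) (y - x1))}.
  by apply: continuous_subspaceT; exact: continuous_dot_sub.
have [y /set_mem[yM [yH yg]] ymin] := compact_EVT_min (ex_intro _ _ Bf) cB dc.
exists y; split=> //; rewrite -1?(dsym y) //.
- rewrite lt_def dotxx_ge0 andbT dotxx_eq0; rewrite subr_eq0.
  by apply: contraNN gx1 => /eqP <-; rewrite yg.
move=> x xy.
have Hx : H x.
  have := le_lt_trans (coord_sqr_le (x - x1) ord_max) (lt_le_trans xy yM).
  rewrite -[X in X < _]real_normK ?num_real// ltr_sqr ?nnegrE ?(ltW h0)//.
  by rewrite !mxE ltr_norml => /andP[+ _]; rewrite /upper_half_space /= /h; lra.
split=> //; rewrite lt_def gap_ge0 ?andbT; last exact: upper_closure.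
apply/negP => /eqP gx; have Bx : B x.
  by split; [exact: ltW (lt_le_trans xy yM)|split=> //; exact: upper_closure].
by have := ymin x (mem_set Bx); rewrite leNgt xy.
Qed.

Lemma gap_near y : closure H y -> m0 < pcos (u y) ->
  exists r sig : R, [/\ 0 < r, 0 < sig & forall x, closure H x ->
    dot (x - y) (x - y) < r ^+ 2 ->
    m0 < pcos (u x) /\ sig <= Num.sqrt (1 - pcos (u x) ^+ 2)].
Proof.
move=> yH my; have y1 := profile_cos_lt1 cos_floor_lt1 (F_lt_closure yH).
pose sig := (1 - pcos (u y)) / 2.
have sig0 : 0 < sig by rewrite divr_gt0// subr_gt0.
have d0 : 0 < Num.min sig (pcos (u y) - m0) by rewrite lt_min sig0 subr_gt0.
have [r r0 rP] := (within_continuousP _ _).1 profile_cos_u_continuous y yH _ d0.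
exists r, sig; split=> // x xH xr.
have xr' : `|x - y| < r.
  apply: (le_lt_trans (norm_le_enorm _)); rewrite -(ger0_norm (ltW r0)) -sqrtr_sqr.
  by rewrite ltr_sqrt// exprn_gt0.
have := rP x xH xr'; rewrite lt_min => /andP[].
have mx := profile_cos_gt0 F c0 cos_floor_gt0 (u x).
have x1 := profile_cos_lt1 cos_floor_lt1 (F_lt_closure xH).
have s2 := profile_sin_gt0 cos_floor_gt0 cos_floor_lt1 (F_lt_closure xH).
have sE : sig = (1 - pcos (u y)) / 2 by [].
rewrite !ltr_norml => /andP[_ h1] /andP[h2 _]; split; first by lra.
apply: (@le_trans _ _ (1 - pcos (u x))); first by move: h1; rewrite sE; lra.
rewrite -[leLHS]ger0_norm ?subr_ge0 ?(ltW x1)// -sqrtr_sqr ler_wsqrtr//.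
by move: (pcos (u x)) mx x1 => m mx x1; nra.
Qed.

(** The lens at a contact point lies in the ball free of contacts, where the
    maximum principle keeps the gap above a multiple of the bump; the bump has
    a positive slope at the contact point, the gap does not. *)
Lemma gap_eq0 x1 : H x1 -> gap x1 = 0.
Proof.
move=> Hx1; apply/eqP/negPn/negP => gx1.
have [ys [ysH gys]] := nearest_contact Hx1 gx1.
set b := x1 - ys; set Bb := dot b b => Bb0 Bbh ball_gap.
have [mys slope] := contact_slope ysH gys.
have [r [sig [r0 sig0 rP]]] := gap_near ysH mys.
have C0 : 0 <= C by rewrite (le_trans _ (u_le Hx1))// ltW// u_gt0.
have [K K0 fK] := derivable_bounded_on f_C1.1 C0.
have h0 : 0 < x1 0 ord_max by [].
have distE x : dot (x - x1) (x - x1) =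
    dot (x - ys) (x - ys) - 2 * dot (x - ys) b + Bb.
  have -> : x - x1 = (x - ys) - b by rewrite /b opprB addrA subrK.
  exact: dot_sub_sqr.
have closure_near x : dot (x - x1) (x - x1) <= Bb -> closure H x.
  move=> xB; apply/closure_upperP.
  have := le_trans (coord_sqr_le (x - x1) ord_max) (le_trans xB Bbh).
  rewrite -[leLHS]real_normK ?num_real// ler_sqr ?nnegrE ?(ltW h0)//.
  by rewrite !mxE ler_norml => /andP[+ _]; lra.
(* Inside the ball of radius [rho] the normal field keeps at least half of the
   squared length of [b]. *)
have [rho rho0 [rho_r rho_b]] : exists2 rho : R, 0 < rho &
    rho ^+ 2 < r ^+ 2 /\ 64 * rho ^+ 2 <= Bb.
  exists (Num.min (r / 2) (Num.sqrt Bb / 8)).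
    by rewrite lt_min !divr_gt0// sqrtr_gt0.
  have sB : 0 < Num.sqrt Bb by rewrite sqrtr_gt0.
  set rho := Num.min _ _.
  have : rho <= Num.min (r / 2) (Num.sqrt Bb / 8) by [].
  have rho0 : 0 < rho by rewrite lt_min !divr_gt0.
  rewrite le_min => /andP[h1 h2]; split.
    by rewrite ltr_sqr ?nnegrE ?(ltW r0) ?(ltW rho0)//; lra.
  have -> : 64 * rho ^+ 2 = (8 * rho) ^+ 2 by ring.
  rewrite -[leRHS](sqr_sqrtr (ltW Bb0)) ler_sqr ?nnegrE ?mulr_ge0 ?(ltW rho0) ?(ltW sB)//.
  by lra.
pose Q := Num.sqrt Bb.
have Q0 : 0 < Q by rewrite sqrtr_gt0.
pose B := 1 + C ^+ 2.
have B0 : 0 < B by rewrite ltr_wpDr ?sqr_ge0.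
have [al al0 alE] : exists2 al : R, 0 < al &
    al * (Bb / 2) / B = 4 * K * Q / sig + 2 * n.+1%:R + 1.
  exists ((4 * K * Q / sig + 2 * n.+1%:R + 1) * (2 * B) / Bb).
    rewrite divr_gt0// mulr_gt0 ?mulr_gt0// ltr_wpDl// addr_ge0// ?mulr_ge0//.
      exact: ltW.
    by rewrite invr_ge0 ltW.
  by field; rewrite !gt_eqF.
pose shell := [set x : V | dot (x - ys) (x - ys) <= rho ^+ 2] `&`
  [set x : V | 0 <= lens ys b x].
have lens_cont : continuous (lens ys b).
  have c1 := @continuous_dot_subl R n.+1 ys b.
  have c2 := @continuous_dot_sub R n.+1 ys.
  apply/continuous_subspace_setT; move/continuous_subspace_setT: c1 => c1.
  by move/continuous_subspace_setT: c2 => c2; exact: (within_sub c1 c2).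
have cshell : compact shell.
  apply: compact_closedI; first exact: compact_dot_le.
  have := @closed_comp _ _ (lens ys b) [set t : R | 0 <= t].
  by apply; [move=> y _; exact: lens_cont|exact: closed_ge].
have shellH x : shell x -> closure H x.
  move=> [_ /= xl]; apply: closure_near; rewrite distE; move: xl; rewrite /lens.
  by have := dotxx_ge0 (x - ys); lra.
have shell_dot x : shell x -> dot (x - ys) b <= Bb / 8.
  move=> [/= xr _]; apply: (le_trans (ler_norm _)).
  have B8 : 0 <= Bb / 8 by rewrite divr_ge0// ltW.
  rewrite -ler_sqr ?nnegrE// real_normK ?num_real//.
  apply: (le_trans (CauchySchwarz _ _)); rewrite -/Bb.
  have -> : (Bb / 8) ^+ 2 = Bb / 64 * Bb by field.
  by rewrite ler_pM2r//; move: xr rho_b; lra.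
have shell_lens x : shell x -> lens ys b x <= Bb.
  move=> sx; have := shell_dot x sx; rewrite /lens.
  by have := dotxx_ge0 (x - ys); move: Bb0; lra.
(* On the far side of the shell the gap is bounded away from zero. *)
have [eps eps0 epsP] : exists2 eps : R, 0 < eps & forall x, shell x ->
    dot (x - ys) (x - ys) = rho ^+ 2 -> eps * bump ys b al x <= gap x.
  pose S := shell `&` [set x : V | rho ^+ 2 <= dot (x - ys) (x - ys)].
  have [[x0 Sx0]|noS] := pselect (S !=set0); last first.
    by exists 1 => // x sx xr; case: noS; exists x; split=> //=; rewrite xr.
  have cS : compact S.
    apply: compact_closedI => //.
    have := @closed_comp _ _ (fun x : V => dot (x - ys) (x - ys)) [set t : R | rho ^+ 2 <= t].
    by apply; [move=> y _; exact: continuous_dot_sub|exact: closed_ge].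
  have gS : {within S, continuous gap}.
    by apply: continuous_subspaceW gap_continuous => x [/shellH].
  have [y /set_mem[sy yr] ymin] := compact_EVT_min (ex_intro _ _ Sx0) cS gS.
  have gy : 0 < gap y.
    suff yB : dot (y - x1) (y - x1) < Bb by have [] := ball_gap y yB.
    rewrite distE; move: sy => [_ /=]; rewrite /lens; move: yr => /=.
    have : 0 < rho ^+ 2 by rewrite exprn_gt0.
    by lra.
  exists (gap y / expR (al * Bb)); first by rewrite divr_gt0// expR_gt0.
  move=> x sx xr.
  have gxy : gap y <= gap x by apply: ymin; apply/mem_set; split=> //=; rewrite xr.
  apply: le_trans gxy; rewrite mulrAC ler_pdivrMr ?expR_gt0// ler_pM2l//.
  rewrite /bump lerBlDr ler_wpDr// ler_expR ler_pM2l//; exact: shell_lens.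
have compare x : shell x -> eps * bump ys b al x <= gap x.
  move=> sx; rewrite leNgt; apply/negP => bad.
  pose psi y := gap y - eps * bump ys b al y.
  have psic : {within shell, continuous psi}.
    apply: within_sub; first by apply: continuous_subspaceW gap_continuous; exact: shellH.
    apply: within_mul; first exact: within_cst.
    apply: within_sub; last exact: within_cst.
    apply: (within_comp (phi := fun s => expR (al * s)) (g := lens ys b)).
      exact: continuous_subspaceT.
    by move=> s; have := is_derive_expR_scaled al s; exact: is_derive_continuous.
  have [x0 /set_mem sx0 x0min] := compact_EVT_min (ex_intro _ _ sx) cshell psic.
  have psi0 : psi x0 < 0.
    by apply: le_lt_trans (x0min x (mem_set sx)) _; rewrite subr_lt0.
  have lens0 : 0 < lens ys b x0.
    rewrite lt_def sx0.2 andbT; apply/negP => /eqP l0.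
    move: psi0; rewrite /psi /bump l0 mulr0 expR0 subrr mulr0 subr0 ltNge.
    by rewrite gap_ge0//; exact: shellH.
  have rho1 : dot (x0 - ys) (x0 - ys) < rho ^+ 2.
    rewrite lt_neqAle sx0.1 andbT; apply/negP => /eqP xr.
    by move: psi0; rewrite subr_lt0 ltNge epsP.
  have nshell : \forall y \near x0, shell y.
    have n1 : \forall y \near x0, 0 < lens ys b y by exact: (cvgr_gt _ (lens_cont x0)).
    have n2 : \forall y \near x0, dot (y - ys) (y - ys) < rho ^+ 2.
      by exact: (cvgr_lt _ (@continuous_dot_sub _ _ ys x0)).
    by apply: filterS2 n1 n2 => y y1 y2; split; exact: ltW.
  have xmin : \forall y \near x0, gap x0 - eps * bump ys b al x0 <=
      gap y - eps * bump ys b al y.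
    by apply: filterS nshell => y sy; apply: x0min; exact/mem_set.
  have A0 := dotxx_ge0 (x0 - ys).
  have xB : dot (x0 - x1) (x0 - x1) < Bb.
    by rewrite distE; move: lens0 A0; rewrite /lens; lra.
  have [Hx0 _] := ball_gap x0 xB.
  have [mx0 sigx0] := rP x0 (shellH x0 sx0) (lt_trans rho1 rho_r).
  have uC : 0 <= u x0 <= C by rewrite u_le// ltW// u_gt0.
  have qqE : dot (normal ys b x0) (normal ys b x0) =
      Bb - 4 * dot (x0 - ys) b + 4 * dot (x0 - ys) (x0 - ys).
    rewrite /normal (dot_sub_sqr b (2 *: (x0 - ys))) !(dotZl, dotZr).
    by rewrite (dotC b (x0 - ys)) -/Bb; ring.
  have qQ : normal ys b x0 0 ord_max <= Q.
    apply: (le_trans (ler_norm _)); rewrite -sqrtr_sqr ler_wsqrtr//.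
    apply: (le_trans (coord_sqr_le _ _)); rewrite qqE.
    by move: lens0; rewrite /lens; lra.
  have test := hopf_test al0 eps0 Hx0 mx0 xmin (fK _ uC) qQ.
  have s0 : 0 < Num.sqrt (1 - pcos (u x0) ^+ 2) := lt_le_trans sig0 sigx0.
  have rhs : 4 * K * Q / Num.sqrt (1 - pcos (u x0) ^+ 2) <= 4 * K * Q / sig.
    by rewrite ler_wpM2l ?mulr_ge0 ?(ltW Q0)// lef_pV2 ?posrE.
  have W0 : 0 < area u x0 ^+ 2 by rewrite exprn_gt0 ?area_gt0.
  have WB : area u x0 ^+ 2 <= B.
    by rewrite area_sqr lerD2l; exact: (grad_sqr_le u_gt0 u_le grad_le Hx0).
  have lhs : al * (Bb / 2) / B <=
      al * dot (normal ys b x0) (normal ys b x0) / area u x0 ^+ 2.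
    apply: ler_pM; rewrite ?invr_ge0 ?(ltW B0)//.
    - by rewrite mulr_ge0 ?(ltW al0)// divr_ge0// ltW.
    - by rewrite ler_pM2l// qqE; have := shell_dot x0 sx0; move: A0; lra.
    - by rewrite lef_pV2 ?posrE.
  rewrite alE in lhs; move: lhs test rhs.
  move: (al * dot _ _ / _) (4 * K * Q / Num.sqrt _) (4 * K * Q / sig) (2 * n.+1%:R).
  by move=> *; lra.
pose b1 := `|b| + 1; have b10 : 0 < b1 by rewrite ltr_wpDl.
pose d := eps * al * Bb / 2; have d0 : 0 < d by rewrite divr_gt0// !mulr_gt0.
have [r2 r20 r2P] := (within_continuousP _ _).1 (@dgap_closure_continuous b) ys ysH d d0.
have min0 : 0 < Num.min 1 (Num.min (rho / Q) (r2 / b1)).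
  by rewrite !lt_min ltr01 !divr_gt0.
have [t [t0 t12 trho tr2]] : exists t : R, [/\ 0 < t, t <= 1 / 2, t * Q <= rho & t * b1 <= r2].
  exists (Num.min 1 (Num.min (rho / Q) (r2 / b1)) / 2); set m := Num.min _ _ in min0 *.
  have m2 : m / 2 <= m by rewrite ler_pdivrMr// ler_peMr ?(ltW min0)// ler1n.
  have : m <= Num.min 1 (Num.min (rho / Q) (r2 / b1)) by [].
  rewrite !le_min => /and3P[m_1 m_2 m_3]; split.
  - by rewrite divr_gt0.
  - by rewrite ler_pM2r ?invr_gt0.
  - by rewrite -ler_pdivlMr//; exact: le_trans m2 m_2.
  - by rewrite -ler_pdivlMr//; exact: le_trans m2 m_3.
have subK (s : R) : ys + s *: b - ys = s *: b by rewrite addrC addKr.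
have Q2 : Q ^+ 2 = Bb by rewrite sqr_sqrtr// ltW.
have lensE (s : R) : lens ys b (ys + s *: b) = s * (1 - s) * Bb.
  by rewrite /lens subK !(dotZl, dotZr) -/Bb; ring.
have st : shell (ys + t *: b).
  split; last by rewrite /= lensE !mulr_ge0 ?subr_ge0 ?(ltW t0) ?(ltW Bb0)//; lra.
  rewrite /= subK dotZl dotZr -/Bb -Q2 mulrA -expr2 -exprMn.
  by rewrite ler_sqr ?nnegrE ?mulr_ge0 ?(ltW t0) ?(ltW Q0) ?(ltW rho0).
have up := compare _ st.
have low : t * d <= eps * bump ys b al (ys + t *: b).
  have : al * lens ys b (ys + t *: b) <= bump ys b al (ys + t *: b).
    by rewrite /bump lerBrDl; exact: expR_ge1Dx.
  rewrite lensE => /(ler_wpM2l (ltW eps0)); apply: le_trans.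
  have -> : eps * (al * (t * (1 - t) * Bb)) = (eps * al * Bb * t) * (1 - t) by ring.
  have -> : t * d = (eps * al * Bb * t) * (1 / 2) by rewrite /d; ring.
  by rewrite ler_wpM2l ?mulr_ge0 ?(ltW eps0) ?(ltW al0) ?(ltW Bb0) ?(ltW t0)//; lra.
have Hs (s : R) : s \in `]0, 1[ -> H (ys + s *: (t *: b)).
  rewrite in_itv/= => /andP[s0 s1]; rewrite scalerA.
  have stB : dot (ys + (s * t) *: b - x1) (ys + (s * t) *: b - x1) < Bb.
    rewrite distE subK !(dotZl, dotZr) -/Bb.
    have -> : s * t * (s * t * Bb) - 2 * (s * t * Bb) + Bb = Bb - (s * t) * (2 - s * t) * Bb by ring.
    have sp : 0 < s * t by rewrite mulr_gt0.
    have sp1 : s * t <= 1 by rewrite mulr_ile1 ?(ltW s0) ?(ltW s1) ?(ltW t0)//; lra.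
    by rewrite gtrBl !mulr_gt0//; lra.
  by have [] := ball_gap _ stB.
have dg y : H y -> is_derive y (t *: b) gap (t * dgap b y).
  by move=> Hy; exact: is_derive_scaled (is_derive_gap b Hy).
have [s s01] := closure_MVT gap_continuous ysH (shellH _ st) Hs dg.
have Hz := Hs s s01; set z := ys + s *: (t *: b) in Hz *.
rewrite gys subr0 => gE.
have zr : `|z - ys| < r2.
  move: s01; rewrite in_itv/= /z => /andP[s0 s1]; rewrite scalerA subK normrZ.
  rewrite gtr0_norm ?mulr_gt0//; apply: lt_le_trans tr2.
  rewrite -mulrA; apply: (@le_lt_trans _ _ (t * `|b|)).
    by rewrite ler_piMl ?(ltW s1)// mulr_ge0// ltW.
  by rewrite ltr_pM2l// ltrDl.
have := r2P z (upper_closure Hz) zr; rewrite slope subr0 /dgap_closure (GE Hz).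
rewrite -/(dgap b z) => dz.
have : t * d <= t * dgap b z by rewrite -gE; exact: le_trans low up.
by rewrite ler_pM2l// leNgt (le_lt_trans (ler_norm _) dz).
Qed.

End Contact.

(** [Phi] is strictly increasing on the range of [u]. *)
Lemma Phi_inj x y : H x -> H y -> Phi (u x) = Phi (u y) -> u x = u y.
Proof.
suff incr x' y' : H x' -> H y' -> u x' < u y' -> Phi (u x') < Phi (u y').
  move=> Hx Hy E; apply/eqP; rewrite eq_le !leNgt.
  by apply/andP; split; apply/negP => /incr; rewrite E ltxx => /(_ _ _)/negP; apply.
move=> Hx Hy xy; have u0 := u_ge0 (upper_closure Hx).
have Fs s : u x' <= s <= u y' -> forall t, 0 <= t <= s -> F t < c0.
  move=> /andP[_ sy] t /andP[t0 ts]; apply: (F_lt_range (upper_closure Hy)).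
  by rewrite t0 (le_trans ts).
have dPhi s : u x' <= s <= u y' -> is_derive s 1 Phi (pcot s).
  by move=> sI; apply: PhiP (Fs s sI); case/andP: sI => xs _; exact: le_trans xs.
have [||s] := @MVT R Phi pcot (u x') (u y') xy.
- by move=> s; rewrite in_itv/= => /andP[s1 s2]; apply: dPhi; rewrite !ltW.
- apply: continuous_in_subspaceT => s /set_mem/=; rewrite in_itv/= => sI.
  have ds := dPhi s sI; exact: is_derive_continuous ds.
rewrite in_itv/= => /andP[s1 s2] E; rewrite -subr_gt0 E.
have sF : F s < c0.
  by apply: (Fs s); rewrite ?(ltW s1) ?(ltW s2) ?lexx//= (le_trans u0 (ltW s1)).
rewrite mulr_gt0 ?subr_gt0// divr_gt0 ?profile_cos_gt0 ?cos_floor_gt0//.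
by rewrite sqrtr_gt0 (profile_sin_gt0 cos_floor_gt0 cos_floor_lt1).
Qed.

End Gap.

Theorem corollary1p8 (R : realType) (n : nat) (n_ge2 : (2 <= n.+1)%N)
    (f : R -> R) (f_C1 : C1_real f)
    (kappa : R) (kappa_neq0 : kappa != 0)
    (u : 'rV[R]_n.+1 -> R)
    (u_C3 : Ck 3 (upper_half_space R n) u)
    (u_C1 : C1_up_to_boundary (upper_half_space R n) u)
    (u_eq : forall x, upper_half_space R n x ->
       mean_curvature_op u x + f (u x) = 0)
    (u_gt0 : forall x, upper_half_space R n x -> 0 < u x)
    (u_dirichlet : forall x, upper_boundary R n x -> u x = 0)
    (u_neumann : forall x, upper_boundary R n x ->
       has_normal_derivative u x (exterior_normal R n) kappa)
    (u_bounded : exists C : R, forall x, upper_half_space R n x ->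
       u x <= C /\ enorm (grad u x) <= C)
    (hF : exists F : R -> R,
       [/\ primitive F f, (forall t, F t <= 0) &
           F 0 >= (Num.sqrt (1 + kappa ^+ 2))^-1 - 1]) :
  parallel (e_last R n) 0 u.
Proof.
have [C uC] := u_bounded; have [F [F_prim F_le0 F0_ge]] := hF.
have u_le x : upper_half_space R n x -> u x <= C by move=> /uC[].
have grad_le x : upper_half_space R n x -> enorm (grad u x) <= C by move=> /uC[].
have F_cont : continuous F by exact: F_continuous F_prim.
have [Phi PhiP] := @profile_antiderivative R F (boundary_energy F kappa) (cos_floor C)
  F_cont (cos_floor_gt0 C) (cos_floor_lt1 C).
have [G [Gc GE Gb]] := boundary_gradient u_C1 u_dirichlet u_neumann.
have gap0 x : upper_half_space R n x -> gap u Phi x = 0.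
  exact: (gap_eq0 f_C1 F_prim F_le0 F0_ge kappa_neq0 u_C3 u_C1 u_eq u_gt0 u_dirichlet
    u_neumann u_le grad_le PhiP Gc GE Gb).
exists (fun t => u (t *: e_last R n)) => x.
rewrite -upper_half_spaceE subr0 dot_e_last => Hx.
set y := x 0 ord_max *: e_last R n.
have yh : y 0 ord_max = x 0 ord_max by rewrite mxE e_last_coord eqxx mulr1.
have Hy : upper_half_space R n y by rewrite /upper_half_space /= yh.
apply: (Phi_inj f_C1 F_prim F_le0 F0_ge kappa_neq0 u_C3 u_C1 u_eq u_gt0 u_dirichlet
    u_neumann u_le grad_le PhiP Hx Hy).
have := gap0 _ Hx; have := gap0 _ Hy; rewrite /gap yh; lra.
Qed.
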